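(* Let $1<p,q<\infty$ satisfy $1/p+1/q\geq 1$. Let $X$ and $Y$ be Banach spaces with unconditional finite-dimensional Schauder decompositions $\{X_i\}_{i\in I}$ and $\{Y_j\}_{j\in J}$, respectively, such that $\{X_i\}_{i\in I}$ has a disjoint lower $p$-estimate and $\{Y_j\}_{j\in J}$ has a disjoint lower $q$-estimate. Suppose that $I$ and $J$ are countable. If $X$ and $Y$ are strongly conditionally weakly compactly generated (SCWCG), then the projective tensor product $X\widehat{\otimes}_\pi Y$ is SCWCG.
   Context: By a subspace of a Banach space we mean a norm closed linear subspace. $B_Z$ denotes the closed unit ball of $Z$. A subset $D$ of a Banach space is conditionally weakly compact if every sequence in $D$ admits a weakly Cauchy subsequence. A Banach space $Z$ is strongly conditionally weakly compactly generated (SCWCG) if there is a conditionally weakly compact set $G \subseteq Z$ such that for every conditionally weakly compact set $C \subseteq Z$ and every $\varepsilon>0$ there is $n\in \mathbb{N}$ such that $C \subseteq nG + \varepsilon B_Z$. An unconditional Schauder decomposition of a Banach space $X$ is a family $\{X_i\}_{i\in I}$ of subspaces of $X$ such that each $x\in X$ can be written in a unique way as $x=\sum_{i\in I} x_i$ with $x_i\in X_i$ for all $i\in I$ and the series unconditionally convergent. For each $i \in I$ there is the associated bounded projection $P_i$ from $X$ onto $X_i$, so that $x=\sum_{i\in I}P_i(x)$ for all $x \in X$; for $C\subseteq I$, $P_C(x):=\sum_{i\in C}P_i(x)$ defines a bounded projection. The decomposition is finite-dimensional if each $X_i$ is finite-dimensional. For $1<p<\infty$, an unconditional Schauder decomposition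 $\{X_i\}_{i\in I}$ of $X$ has a disjoint lower $p$-estimate if there is a constant $c>0$ such that, for every finite collection $C_1,\dots,C_r$ of pairwise disjoint finite subsets of $I$ and every $x\in X$, $\left(\sum_{k=1}^r \|P_{C_k}(x)\|^p\right)^{1/p} \leq c \|x\|$. $\widehat{\otimes}_\pi$ denotes the projective tensor product of Banach spaces. *)

(* Defs.v *)
From HB Require Import structures.
From mathcomp Require Import all_boot all_order all_algebra finmap.
From mathcomp Require Import all_classical all_reals all_analysis.
From mathcomp.analysis.showcase Require summability.
Set Implicit Arguments.
Unset Strict Implicit.
Unset Printing Implicit Defensive.
Import Order.TTheory GRing.Theory Num.Theory.
Import numFieldNormedType.Exports.
Local Open Scope classical_set_scope.
Local Open Scope ring_scope.

(* Banach spaces are real: completeNormedModType R with R : realType. *)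

Section scwcg.
Context {R : realType} {Z : completeNormedModType R}.

Definition weakly_cauchy (u : nat -> Z) : Prop :=
  forall f : {linear Z -> R^o}, continuous f ->
    cauchy ((fun n => f (u n) : R^o) @ \oo).

Definition cond_weakly_compact (D : set Z) : Prop :=
  forall u : nat -> Z, (forall n, D (u n)) ->
    exists2 phi : nat -> nat,
      {homo phi : m n / (m < n)%N} & weakly_cauchy (u \o phi).

End scwcg.

Definition SCWCG {R : realType} (Z : completeNormedModType R) : Prop :=
  exists2 G : set Z, cond_weakly_compact G &
    forall C : set Z, cond_weakly_compact C ->
      forall e : R, 0 < e -> exists n : nat,
        C `<=` [set n%:R *: g + e *: z | g in G & z in closed_ball (0 : Z) 1].

Section decomposition.
Context {R : realType} {X : completeNormedModType R} {I : choiceType}.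
Implicit Types (D : I -> set X) (V : set X) (x : X) (u : I -> X).

Definition closed_subspace V : Prop :=
  [/\ closed V, V 0 & forall (a : R) x y, V x -> V y -> V (a *: x + y)].

Definition finite_dim V : Prop :=
  exists (n : nat) (v : 'I_n -> X),
    V = [set \sum_(k < n) a k *: v k | a in [set: 'I_n -> R]].

(* Unconditional convergence of sum_i u_i to x: the finite partial sums
   converge along the net of finite subsets of I ordered by inclusion. *)
Definition expansion D x u : Prop :=
  (forall i, D i (u i)) /\
  summability.partial_sum u @ summability.totally --> x.

Definition uncond_decomposition D : Prop :=
  (forall i, closed_subspace (D i)) /\
  (forall x, exists! u : I -> X, expansion D x u).

Definition uncond_fdd D : Prop :=
  uncond_decomposition D /\ (forall i, finite_dim (D i)).

(* The value 0 is only used when x has no expansion, which cannot happen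
   under uncond_decomposition. *)
Definition decomp_proj D (i : I) x : X := xget (fun=> 0) (expansion D x) i.

Definition decomp_fproj D (C : {fset I}) x : X :=
  \sum_(i <- C) decomp_proj D i x.

Definition disjoint_lower_estimate (p : R) D : Prop :=
  exists2 c : R, 0 < c &
    forall (r : nat) (C : 'I_r -> {fset I}),
      (forall k l, k != l -> [disjoint C k & C l]%fset) ->
      forall x, (\sum_(k < r) `|decomp_fproj D (C k) x| `^ p) `^ p^-1
                <= c * `|x|.

End decomposition.

Section projective_tensor.
Context {R : realType} {X Y : completeNormedModType R}.
Implicit Types s t : seq (X * Y).

(* The list [:: (x1, y1); ..; (xn, yn)] stands for the element
   x1 (x) y1 + .. + xn (x) yn of the algebraic tensor product of X and Y;
   two lists stand for the same element iff no bilinear form (continuous or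
   not) separates them. *)
Definition tensor_eq s t : Prop :=
  forall B : {bilinear X -> Y -> R^o},
    \sum_(w <- s) B w.1 w.2 = \sum_(w <- t) B w.1 w.2.

Definition projective_norm s : R :=
  inf [set \sum_(w <- t) `|w.1| * `|w.2| | t in tensor_eq s].

(* (Z, b) is the projective tensor product of X and Y: Z is complete, and
   x (x) y |-> b x y extends to an isometry from the algebraic tensor product
   with the projective norm onto a dense subspace of Z.  This determines
   (Z, b) up to isometric isomorphism. *)
Definition is_projective_tensor (Z : completeNormedModType R)
    (b : {bilinear X -> Y -> Z}) : Prop :=
  (forall s, `|\sum_(w <- s) b w.1 w.2| = projective_norm s) /\
  dense (range (fun s => \sum_(w <- s) b w.1 w.2)).

End projective_tensor.

(* Main.v *)
From HB Require Import structures.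
Require Import Defs.
From mathcomp Require Import all_boot all_order all_algebra finmap.
From mathcomp Require Import all_classical all_reals all_analysis.
From mathcomp Require Import ring lra.
Import Order.TTheory GRing.Theory Num.Theory.
Import numFieldNormedType.Exports.
Set Implicit Arguments.
Unset Strict Implicit.
Unset Printing Implicit Defensive.
Local Open Scope classical_set_scope.
Local Open Scope ring_scope.

(** Let P_n and Q_n be the partial-sum projections of X and Y along
enumerations of the two index sets, and split every z in the tensor product as
  z = R_n z + (1 - P_n) (x) (1 - Q_n) z,
  R_n = 1 (x) Q_n + (P_n (x) 1) (1 - 1 (x) Q_n).
Two facts together give the theorem.

The tails (1 - P_n) (x) (1 - Q_n) z are small uniformly on a conditionally
weakly compact set C ([tail_uniform]).  Otherwise a gliding hump produces
n_0 < n_1 < n_2 < ..., points z_k of C and e > 0 such that the diagonal blocks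
T_k = (P_{n_{k+1}} - P_{n_k}) (x) (Q_{n_{k+1}} - Q_{n_k}) satisfy
|T_k z_k| >= e.  Let g_k be a norming functional of T_k z_k.  If
c and d are the constants of the two lower estimates, then 1/p + 1/q >= 1
gives, as in the inequality of Hoelder,
  sum_k |T_k (x (x) y)| <= 2 c d |x| |y|,
so z |-> (g_k (T_k z))_k is a bounded operator into l^1
([block_functionals_sum]).  It sends C to a conditionally weakly compact set
of l^1, hence, by the Schur property, to a relatively norm compact one, on
which the k-th coordinates tend to 0 uniformly: this contradicts
|g_k (T_k z_k)| >= e.  The argument of Schur is carried out directly for such
a family of functionals in [schur_diagonal].

The parts R_n z are controlled by the generating sets of X and Y.  Since P_n
has finite rank, P_n = sum_i f_i w_i, we have
P_n (x) 1 = sum_i w_i (x) (f_i (x) 1), where f_i (x) 1 maps the tensor product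
to Y.  It sends C to a conditionally weakly compact set, which lies near some
multiple of the generating set of Y.  So R_n C lies near a member of a
countable family of conditionally weakly compact sets that does not depend
on C.

Finally, countably many sets G_n can be replaced by one: conditionally weakly
compact sets are bounded, and the union of the sets c_n G_n is conditionally
weakly compact when the scalars c_n > 0 decrease fast enough
([cwc_approximable_SCWCG]). *)

(** * Norming functionals *)

Section hahn_banach.
Context {R : realType} {V : normedModType R}.
Implicit Types (G H : set (V * R^o)) (w x : V).

(** A set of pairs (x, t), thought of as the graph of a partially defined
functional.  Domination by the norm makes it single-valued: if (0, t) lies in
it, then so does (0, - t), whence t = 0. *)
Definition dominated_graph G : Prop :=
  (forall (a : R) u v, G u -> G v -> G (a *: u + v)) /\
  (forall u, G u -> u.2 <= `|u.1|).

Definition norming_line w : set (V * R^o) :=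
  [set (c *: w, c * `|w|) | c in [set: R]].

(** The extension step of the Hahn-Banach theorem: by the triangle inequality
every lower constraint on the value at x0 lies below every upper one. *)
Lemma dominated_graphU1 G x0 : dominated_graph G -> G 0 ->
  exists2 H, dominated_graph H & G `<=` H /\ exists t, H (x0, t).
Proof.
move=> [Glin Gle] G0.
(* the value at x0 must lie above S and below all numbers |u.1 + x0| - u.2 *)
pose S := [set u.2 - `|u.1 - x0| | u in G].
have ub_S u : G u -> ubound S (`|u.1 + x0| - u.2).
  move=> Gu _ [v Gv <-].
  have /Gle /= : G (1 *: u + v) by apply: Glin.
  rewrite !scale1r => h.
  suff : `|u.1 + v.1| <= `|u.1 + x0| + `|v.1 - x0| by lra.
  by rewrite (_ : u.1 + v.1 = (u.1 + x0) + (v.1 - x0)) ?ler_normD // addrACA subrr addr0.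
have supS : has_sup S.
  split; first by exists (0 - `|0 - x0|), 0.
  by exists (`|0 + x0| - 0); exact: (ub_S 0).
pose t0 := sup S.
have t0l u : G u -> u.2 - `|u.1 - x0| <= t0.
  by move=> Gu; apply: ub_le_sup; [case: supS|exists u].
have t0r u : G u -> t0 <= `|u.1 + x0| - u.2.
  by move=> Gu; apply: ge_sup; [case: supS|exact: ub_S].
have Gsc (a : R) u : G u -> G (a *: u).
  by move=> Gu; rewrite -[a *: u]addr0; exact: Glin.
exists [set u | exists2 v, G v & exists a : R, u = v + a *: (x0, t0)].
  split=> [a _ _ [u Gu [c ->]] [v Gv [d ->]]|_ [u Gu [c ->]]].
    exists (a *: u + v); first exact: Glin.
    exists (a * c + d).
    by rewrite scalerDr scalerDl scalerA addrACA.
  rewrite /=; have [c0|c0|->] := ltrgtP c 0; last first.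
  - by rewrite !scale0r !addr0; exact: Gle.
  - have := t0r _ (Gsc c^-1 u Gu).
    rewrite -(ler_pM2l c0) mulrBr -[X in X * `|_|](gtr0_norm c0) -normrZ.
    rewrite scalerDr /= !scalerA divff ?gt_eqF// scale1r.
    by rewrite {1}/GRing.scale/= mulrA divff ?gt_eqF// mul1r lerBrDl.
  - have c0' : 0 < - c by rewrite oppr_gt0.
    have := t0l _ (Gsc (- c)^-1 u Gu).
    rewrite -(ler_pM2l c0') mulrBr -[X in X * `|_|](gtr0_norm c0') -normrZ.
    rewrite scalerBr /= !scalerA divff ?gt_eqF// scale1r scaleNr opprK.
    rewrite {1}/GRing.scale/= mulrA divff ?gt_eqF// mul1r.
    by rewrite /GRing.scale/= mulNr; lra.
split; first by move=> u Gu; exists u => //; exists 0; rewrite scale0r addr0.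
by exists t0, 0 => //; exists 1; rewrite scale1r add0r.
Qed.

(** Zorn's lemma is applied to the sets G such that G together with the
line through (w, |w|) is dominated.  With this choice the empty chain is
harmless, and a maximal G is total by the extension step. *)
Lemma norming_functional w :
  exists2 f : V -> R^o,
    (forall a x y, f (a *: x + y) = a *: f x + f y) /\
    (forall x, `|f x| <= `|x|) & f w = `|w|.
Proof.
pose L := norming_line w.
have Ldom : dominated_graph L.
  split=> [a _ _ [c _ <-] [d _ <-]|_ [c _ <-]] /=.
    exists (a * c + d) => //.
    congr pair; first by rewrite scalerDl -scalerA.
    by rewrite mulrDl -mulrA.
  by rewrite normrZ ler_wpM2r// ler_norm.
pose P G := dominated_graph (G `|` L).
have [F FP Ftot|G [PG Gmax]] := @Zorn_bigcup _ P.
  have [[X0 FX0]|F0] := pselect (exists X, F X); last first.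
    rewrite /P (_ : \bigcup_(X in F) X = set0) ?set0U//.
    by rewrite -subset0 => x [X FX _]; apply: F0; exists X.
  have pick1 u : (\bigcup_(X in F) X `|` L) u -> exists2 X, F X & (X `|` L) u.
    case=> [[X FX Xu]|Lu]; first by exists X => //; left.
    by exists X0 => //; right.
  split=> [a u v /pick1[X FX Xu] /pick1[Y FY Yv]|u /pick1[X FX Xu]].
    have [Z FZ [Zu Zv]] : exists2 Z, F Z & (Z `|` L) u /\ (Z `|` L) v.
      have [XY|YX] := Ftot X Y FX FY.
        by exists Y => //; split=> //; exact: setSU Xu.
      by exists X => //; split=> //; exact: setSU Yv.
    by have [/(_ a u v Zu Zv) [?|?] _] := FP Z FZ; [left; exists Z|right].
  by have [_] := FP X FX; exact.
have GL0 : (G `|` L) 0.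
  by right; exists 0 => //; rewrite scale0r mul0r.
have total x : exists t, (G `|` L) (x, t).
  have [H Hdom [GH [t Ht]]] := @dominated_graphU1 _ x PG GL0.
  have HL : H `|` L = H.
    by apply/setUidl => u Lu; apply: GH; right.
  exists t; left; apply: contrapT => nG.
  apply: (Gmax H); last by rewrite /P HL.
  by split=> [u Gu|/(_ _ Ht)//]; apply: GH; left.
have [f fE] := choice total.
case: PG => Plin Ple.
have funct x s t : (G `|` L) (x, s) -> (G `|` L) (x, t) -> s = t.
  suff H (s' t' : R) : (G `|` L) (x, s') -> (G `|` L) (x, t') -> s' <= t'.
    by move=> h1 h2; apply/le_anti/andP; split; apply: H.
  move=> h1 h2; have := Ple _ (Plin (-1) _ _ h2 h1).
  by rewrite /= !scaleN1r addNr normr0 addrC subr_le0.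
exists f; last first.
  by apply: (funct w) (fE w) _; right; exists 1 => //; rewrite scale1r mul1r.
split=> [a x y|x].
  by apply: (funct (a *: x + y)) (fE _) _; exact: (Plin a (x, f x) (y, f y)).
rewrite ler_norml; apply/andP; split; last exact: Ple (fE x).
have := Ple _ (Plin (-1) _ _ (fE x) GL0).
by rewrite /= !scaleN1r !addr0 normrN lerNl.
Qed.

End hahn_banach.

(** * Bounded operators and series of functionals *)

Section bounded_operators.
Context {R : realType}.
Implicit Types U V W : normedModType R.

(** The bound is an explicit parameter, since uniform bounds over families
of operators are what the estimates need. *)
Definition bounded_op {V W} (K : R) (f : V -> W) : Prop :=
  [/\ 0 <= K, forall a x y, f (a *: x + y) = a *: f x + f y &
      forall x, `|f x| <= K * `|x|].

Lemma bounded_op_ge0 {V W} K (f : V -> W) : bounded_op K f -> 0 <= K.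
Proof. by case. Qed.

Lemma bounded_op_le {V W} K (f : V -> W) : bounded_op K f ->
  forall x, `|f x| <= K * `|x|.
Proof. by case. Qed.

Lemma bounded_opP {V W} K (f : V -> W) : bounded_op K f ->
  forall a x y, f (a *: x + y) = a *: f x + f y.
Proof. by case. Qed.

Lemma bounded_op0 {V W} K (f : V -> W) : bounded_op K f -> f 0 = 0.
Proof.
by move=> [_ fP _]; have := fP (-1) 0 0; rewrite scaler0 addr0 scaleN1r addNr.
Qed.

Lemma bounded_opZ {V W} K (f : V -> W) : bounded_op K f ->
  forall a x, f (a *: x) = a *: f x.
Proof.
by move=> fK a x; rewrite -[a *: x]addr0 (bounded_opP fK) (bounded_op0 fK) addr0.
Qed.

Lemma bounded_opD {V W} K (f : V -> W) : bounded_op K f ->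
  forall x y, f (x + y) = f x + f y.
Proof.
by move=> fK x y; rewrite -[x]scale1r (bounded_opP fK) !scale1r.
Qed.

Lemma bounded_opB {V W} K (f : V -> W) : bounded_op K f ->
  forall x y, f (x - y) = f x - f y.
Proof.
by move=> fK x y; rewrite (bounded_opD fK) -scaleN1r (bounded_opZ fK) scaleN1r.
Qed.

Lemma bounded_op_sum {V W} K (f : V -> W) : bounded_op K f ->
  forall (I : Type) (r : seq I) (F : I -> V),
  f (\sum_(i <- r) F i) = \sum_(i <- r) f (F i).
Proof.
move=> fK I r F; elim/big_rec2: _ => [|i y x _ <-]; first exact: bounded_op0 fK.
by rewrite (bounded_opD fK).
Qed.

Lemma bounded_op_id V : bounded_op 1 (id : V -> V).
Proof. by split=> // x; rewrite mul1r. Qed.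

Lemma bounded_op_comp {U V W} K L (f : V -> W) (g : U -> V) :
  bounded_op K f -> bounded_op L g -> bounded_op (K * L) (f \o g).
Proof.
move=> [K0 fP fK] [L0 gP gL]; split=> [|a x y|x] /=; first exact: mulr_ge0.
  by rewrite gP fP.
by apply: (le_trans (fK _)); rewrite -mulrA ler_wpM2l.
Qed.

Lemma bounded_op_add {V W} K L (f g : V -> W) :
  bounded_op K f -> bounded_op L g -> bounded_op (K + L) (fun x => f x + g x).
Proof.
move=> [K0 fP fK] [L0 gP gL]; split=> [|a x y|x] /=; first exact: addr_ge0.
  by rewrite gP fP scalerDr addrACA.
by apply: (le_trans (ler_normD _ _)); rewrite mulrDl lerD.
Qed.

Lemma bounded_op_scale {V W} K (a : R) (f : V -> W) :
  bounded_op K f -> bounded_op (`|a| * K) (fun x => a *: f x).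
Proof.
move=> [K0 fP fK]; split=> [|b x y|x] /=; first exact: mulr_ge0.
  by rewrite fP scalerDr !scalerA mulrC.
by rewrite normrZ -mulrA ler_wpM2l.
Qed.

Lemma bounded_op_sub {V W} K L (f g : V -> W) :
  bounded_op K f -> bounded_op L g -> bounded_op (K + L) (fun x => f x - g x).
Proof.
move=> fK /(bounded_op_scale (-1)); rewrite normrN1 mul1r => gL.
rewrite (_ : (fun x => f x - g x) = fun x => f x + -1 *: g x).
  exact: bounded_op_add.
by apply/funext => x; rewrite scaleN1r.
Qed.

Lemma bounded_op_zero {V W} : bounded_op 0 (fun _ : V => 0 : W).
Proof.
by split=> // [a x y|x]; rewrite ?scaler0 ?addr0// normr0 mul0r.
Qed.

Lemma bounded_op_bigsum {V W} (I : Type) (r : seq I) (F : I -> V -> W) :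
  (forall i, exists K, bounded_op K (F i)) ->
  exists K, bounded_op K (fun x => \sum_(i <- r) F i x).
Proof.
move=> FK; elim: r => [|i r [K ih]].
  exists 0; rewrite (_ : (fun _ => _) = fun=> 0); first exact: bounded_op_zero.
  by apply/funext => x; rewrite big_nil.
have [L FL] := FK i; exists (L + K).
rewrite (_ : (fun _ => _) = fun x => F i x + \sum_(i <- r) F i x).
  exact: bounded_op_add.
by apply/funext => x; rewrite big_cons.
Qed.

End bounded_operators.

Section norming.
Context {R : realType} {V : normedModType R}.

Lemma norming_bounded_op (w : V) :
  exists2 f : V -> R^o, bounded_op 1 f & f w = `|w|.
Proof.
have [f [fP fle] fw] := norming_functional w; exists f => //.
by split=> // x; rewrite mul1r.
Qed.

(** Reduces identities between vectors to identities between scalars, which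
is the form in which equality of tensors is given. *)
Lemma functionals_separate (x y : V) :
  (forall (f : V -> R^o) K, bounded_op K f -> f x = f y) -> x = y.
Proof.
move=> xy; have [f f1 fx] := norming_bounded_op (x - y).
apply/eqP; rewrite -subr_eq0 -normr_eq0 -fx (bounded_opB f1) subr_eq0.
by rewrite (xy _ _ f1).
Qed.

End norming.

Section sequences.
Context {R : realType}.

Lemma cauchy_eps {V : normedModType R} (u : nat -> V) :
  cauchy (u @ \oo) <->
  forall e : R, 0 < e -> exists N, forall m n, (N <= m)%N -> (N <= n)%N ->
    `|u m - u n| < e.
Proof.
split=> [/cauchy_ballP uC e e0|uC].
  have [[A B] [/= [N _ NA] [M _ MB]] AB] := uC e e0.
  exists (maxn N M) => m n; rewrite !geq_max => /andP[Nm _] /andP[_ Mn].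
  by have := AB (u m, u n); rewrite /= -ball_normE; apply; split; [exact: NA|exact: MB].
apply/cauchy_ballP => e e0; have [N HN] := uC e e0.
exists (u @` [set n | (N <= n)%N], u @` [set n | (N <= n)%N]) => /=.
  by split; exists N => // n Nn; exists n.
by move=> [_ _] /= [[m Nm <-] [n Nn <-]]; rewrite -ball_normE; exact: HN.
Qed.

Lemma cauchy_limit {V : completeNormedModType R} (u : nat -> V) :
  (forall e : R, 0 < e -> exists N, forall m n, (N <= m)%N -> (N <= n)%N ->
    `|u m - u n| < e) ->
  exists l, forall e : R, 0 < e -> exists N, forall n, (N <= n)%N -> `|u n - l| < e.
Proof.
move=> /cauchy_eps /cauchy_cvgP uC; exists (lim (u @ \oo)) => e e0.
have /cvgrPdistC_lt /(_ e e0) [N _ HN] := uC.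
by exists N => n; exact: HN.
Qed.

Lemma homo_ltn_ge (phi : nat -> nat) :
  {homo phi : m n / (m < n)%N} -> forall n, (n <= phi n)%N.
Proof. by move=> phi_lt; elim=> // n ih; exact: leq_ltn_trans (phi_lt _ _ (ltnSn n)). Qed.

(** The form of dependent choice behind every gliding-hump construction
below. *)
Lemma dependent_subsequence (Q : nat -> nat -> Prop) :
  (forall n, exists2 m, (n < m)%N & Q n m) ->
  exists2 phi : nat -> nat, {homo phi : m n / (m < n)%N} &
    forall k, Q (phi k) (phi k.+1).
Proof.
move=> H; have /choice[g Hg] : forall n, exists m, (n < m)%N /\ Q n m.
  by move=> n; have [m ? ?] := H n; exists m.
exists (fun k => iter k g 0%N); last by move=> k; case: (Hg (iter k g 0%N)).
by apply: (homo_ltn ltn_trans) => k; case: (Hg (iter k g 0%N)).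
Qed.

Lemma frequent_subsequence (P : nat -> Prop) :
  (forall N, exists2 k, (N <= k)%N & P k) ->
  exists2 phi : nat -> nat, {homo phi : m n / (m < n)%N} & forall k, P (phi k).
Proof.
move=> H; have [|phi phi_lt Pphi] := @dependent_subsequence (fun _ m => P m).
  by move=> n; have [m] := H n.+1; exists m.
by exists (phi \o succn) => [m n mn|k]; [apply: phi_lt|exact: Pphi].
Qed.

(** Both ranges are transported by phi, so that the same estimate serves for
heads and for tails of series. *)
Lemma sum_subsequence_le (a : nat -> R) (phi : nat -> nat) m N :
  (forall k, 0 <= a k) -> {homo phi : m n / (m < n)%N} ->
  \sum_(m <= k < N) a (phi k) <= \sum_(phi m <= k < phi N) a k.
Proof.
move=> a0 phi_lt.
have [mN|Nm] := leqP m N; last by rewrite big_geq 1?ltnW// sumr_ge0.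
elim: N mN => [|N ih]; first by rewrite leqn0 => /eqP ->; rewrite !big_geq.
rewrite leq_eqVlt => /predU1P[->|mN]; first by rewrite !big_geq.
rewrite big_nat_recr//= (le_trans (lerD (ih _) (lexx _)))//.
have lt := phi_lt _ _ (ltnSn N).
have le : (phi m <= phi N)%N by rewrite (ltnW_homo phi_lt).
rewrite [leRHS](big_cat_nat (n := (phi N).+1))//= ?(leq_trans le)//.
by rewrite big_nat_recr//= lerDl sumr_ge0.
Qed.

(** One n serves all N: it is chosen so that the sum up to n is within e of
the supremum of the partial sums. *)
Lemma summable_tail (a : nat -> R) (M : R) : (forall k, 0 <= a k) ->
  (forall N, \sum_(0 <= k < N) a k <= M) -> forall e : R, 0 < e ->
  exists n, forall N, \sum_(n <= k < N) a k <= e.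
Proof.
move=> a0 aM e e0.
pose S := range (fun N => \sum_(0 <= k < N) a k).
have supS : has_sup S.
  by split; [exists (\sum_(0 <= k < 0) a k), 0%N|exists M => _ [N _ <-]].
have [_ [n _ <-] Hn] := sup_adherent e0 supS.
exists n => N; have [nN|Nn] := leqP n N; last first.
  by rewrite big_geq ?(ltnW Nn)// ltW.
have : \sum_(0 <= k < N) a k <= sup S.
  by apply: ub_le_sup; [case: supS|exists N].
rewrite (big_cat_nat (n := n))//=; move: Hn; lra.
Qed.

(** The pointwise sum f of an absolutely convergent series of functionals is
again a functional; its distance to a partial sum at z is at most any bound for
the absolute tails at z. *)
Lemma sum_functionals {V : normedModType R} (psi : nat -> V -> R^o) (M : R) :
  0 <= M ->
  (forall k, exists K, bounded_op K (psi k)) ->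
  (forall z N, \sum_(0 <= k < N) `|psi k z| <= M * `|z|) ->
  exists2 f : V -> R^o, bounded_op M f &
    forall z n B, (forall N, \sum_(n <= k < N) `|psi k z| <= B) ->
      `|f z - \sum_(0 <= k < n) psi k z| <= B.
Proof.
move=> M0 psiK psiM.
have /choice[f fE] : forall z, exists l : R^o, forall e : R, 0 < e -> exists N, forall n,
    (N <= n)%N -> `|\sum_(0 <= k < n) psi k z - l| < e.
  move=> z; apply: (@cauchy_limit R^o) => e e0.
  have e20 : 0 < e / 2 by rewrite divr_gt0.
  have [N HN] := @summable_tail (fun k => `|psi k z|) _
    (fun k => normr_ge0 _) (psiM z) (e / 2) e20.
  suff H m n : (N <= m)%N -> (m <= n)%N ->
      `|\sum_(0 <= k < n) psi k z - \sum_(0 <= k < m) psi k z| <= e / 2.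
    exists N => m n Nm Nn; apply: (@le_lt_trans _ _ (e / 2)); last by lra.
    by have [mn|/ltnW nm] := leqP m n; [rewrite distrC|]; exact: H.
  move=> Nm mn; rewrite (big_cat_nat (n := m))//= [X in `|X|]addrAC subrr add0r.
  apply: (le_trans (ler_norm_sum _ _ _)); apply: le_trans (HN n).
  by rewrite [leRHS](big_cat_nat (n := m))//= lerDr sumr_ge0.
have tail z n B : (forall N, \sum_(n <= k < N) `|psi k z| <= B) ->
    `|f z - \sum_(0 <= k < n) psi k z| <= B.
  move=> HB; apply/ler_addgt0Pl => e e0; have [N HN] := fE z e e0.
  have /HN h : (N <= maxn N n)%N by rewrite leq_maxl.
  have := HB (maxn N n); move: h.
  rewrite (big_cat_nat (n := n))//= ?leq_maxr//.
  set S := \sum_(0 <= k < n) _; set T := \sum_(n <= k < maxn N n) _.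
  move=> h1 h2; have : `|T| <= B.
    by apply: le_trans h2; exact: ler_norm_sum.
  rewrite (_ : f z - S = - (S + T - f z) + T); last by ring.
  move=> h3; apply: (le_trans (ler_normD _ _)); rewrite normrN.
  by apply: lerD => //; exact: ltW.
exists f => //; split=> // [a x y|z]; last first.
  by have := tail z 0%N (M * `|z|) (psiM z); rewrite big_nil subr0.
apply/eqP; rewrite -subr_eq0 -normr_le0; apply/ler_addgt0Pl => e e0; rewrite addr0.
(* the error terms add up to (|a| + 2) d *)
pose d := e / (`|a| + 2).
have a2 : 0 < `|a| + 2 by rewrite ltr_wpDl.
have d0 : 0 < d by rewrite divr_gt0.
have [N1 H1] := fE (a *: x + y) d d0; have [N2 H2] := fE x d d0.
have [N3 H3] := fE y d d0.
pose N := maxn N1 (maxn N2 N3).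
have /H1 h1 : (N1 <= N)%N by rewrite leq_maxl.
have /H2 h2 : (N2 <= N)%N by rewrite /N !leq_max leqnn orbT.
have /H3 h3 : (N3 <= N)%N by rewrite /N !leq_max leqnn !orbT.
move: h1 h2 h3.
rewrite (_ : \sum_(0 <= k < N) psi k (a *: x + y) =
    a *: \sum_(0 <= k < N) psi k x + \sum_(0 <= k < N) psi k y); last first.
  rewrite scaler_sumr -big_split; apply: eq_bigr => k _ /=.
  by have [K /bounded_opP ->] := psiK k.
set A := \sum_(_ <= _ < _) _; set B := \sum_(_ <= _ < _) _ => h1 h2 h3.
rewrite (_ : _ - _ = - (a *: A + B - f (a *: x + y)) + a *: (A - f x) + (B - f y)); last first.
  by rewrite /GRing.scale/=; ring.
rewrite (le_trans (ler_normD _ _))// (le_trans (lerD (ler_normD _ _) (lexx _)))//.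
rewrite normrN normrZ.
have : `|a| * `|A - f x| <= `|a| * d by rewrite ler_wpM2l// ltW.
have : e = `|a| * d + d * 2 by rewrite /d; field; rewrite gt_eqF.
lra.
Qed.

End sequences.

(** * Conditionally weakly compact sets *)

Section weakly_cauchy.
Context {R : realType}.
Implicit Types V W : completeNormedModType R.

(** Together with [bounded_op_continuous], the bridge between continuous
linear forms and functionals with an explicit bound. *)
Lemma continuous_bounded_op (V : normedModType R) (f : {linear V -> R^o}) :
  continuous f -> exists K, bounded_op K f.
Proof.
move=> /linear_bounded_continuous /linear_boundedP [M [_ HM]].
exists (`|M| + 1); split=> [|a x y|x]; first by rewrite addr_ge0.
  by rewrite linearP.
by apply: HM; rewrite (le_lt_trans (ler_norm M))// ltrDl.
Qed.

Lemma bounded_op_continuous (V : normedModType R) K (f : V -> R^o) :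
  bounded_op K f -> exists2 g : {linear V -> R^o}, continuous g & g = f :> (V -> R^o).
Proof.
move=> fK.
pose fL := GRing.isLinear.Build R V R^o *:%R f (bounded_opP fK).
pose g : {linear V -> R^o} := HB.pack f fL.
exists g => //; apply/linear_bounded_continuous/linear_boundedP.
exists K; split; first exact: num_real.
by move=> r Kr x; rewrite (le_trans (bounded_op_le fK x))// ler_wpM2r// ltW.
Qed.

Lemma weakly_cauchyP V (u : nat -> V) :
  weakly_cauchy u <->
  forall K (f : V -> R^o), bounded_op K f -> forall e : R, 0 < e ->
  exists N, forall m n, (N <= m)%N -> (N <= n)%N -> `|f (u m) - f (u n)| < e.
Proof.
split=> [uC K f /bounded_op_continuous[g gc <-]|uC f /continuous_bounded_op[K fK]].
  by apply/(@cauchy_eps _ R^o); exact: uC.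
by apply/(@cauchy_eps _ R^o); exact: uC fK.
Qed.

Lemma weakly_cauchy_subsequence V (u : nat -> V) phi :
  {homo phi : m n / (m < n)%N} -> weakly_cauchy u -> weakly_cauchy (u \o phi).
Proof.
move=> phi_lt /weakly_cauchyP uC; apply/weakly_cauchyP => K f fK e e0.
have [N HN] := uC K f fK e e0; exists N => m n Nm Nn.
apply: HN; first exact: leq_trans Nm (homo_ltn_ge phi_lt m).
exact: leq_trans Nn (homo_ltn_ge phi_lt n).
Qed.

Lemma weakly_cauchy_image V W K (T : V -> W) u :
  bounded_op K T -> weakly_cauchy u -> weakly_cauchy (T \o u).
Proof.
move=> TK /weakly_cauchyP uC; apply/weakly_cauchyP => L f fL.
exact: uC (bounded_op_comp fL TK).
Qed.

Lemma weakly_cauchy_add V (u v : nat -> V) :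
  weakly_cauchy u -> weakly_cauchy v -> weakly_cauchy (fun n => u n + v n).
Proof.
move=> /weakly_cauchyP uC /weakly_cauchyP vC; apply/weakly_cauchyP => K f fK e e0.
have e20 : 0 < e / 2 by rewrite divr_gt0.
have [N HN] := uC K f fK _ e20; have [M HM] := vC K f fK _ e20.
exists (maxn N M) => m n; rewrite !geq_max => /andP[Nm Mm] /andP[Nn Mn].
rewrite !(bounded_opD fK) opprD addrACA (le_lt_trans (ler_normD _ _))//.
by rewrite [ltRHS](splitr e) ltrD ?HN ?HM.
Qed.

Lemma norm_null_weakly_cauchy V (u : nat -> V) :
  (forall e : R, 0 < e -> exists N, forall n, (N <= n)%N -> `|u n| <= e) ->
  weakly_cauchy u.
Proof.
move=> u0; apply/weakly_cauchyP => K f fK e e0.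
have K0 := bounded_op_ge0 fK.
have d0 : 0 < e / (2 * K + 1) by rewrite divr_gt0// ltr_wpDl// mulr_ge0.
have [N HN] := u0 _ d0; exists N => m n /HN um /HN un.
rewrite (le_lt_trans (ler_normB _ _))//.
have := ler_wpM2l K0 um; have := ler_wpM2l K0 un.
have := bounded_op_le fK (u m); have := bounded_op_le fK (u n).
suff : K * (e / (2 * K + 1)) + K * (e / (2 * K + 1)) < e by lra.
rewrite (_ : _ + _ = e * (2 * K / (2 * K + 1))); last by ring.
by rewrite gtr_pMr// ltr_pdivrMr ?mul1r; lra.
Qed.

Lemma cwc_image V W K (T : V -> W) C :
  bounded_op K T -> cond_weakly_compact C -> cond_weakly_compact (T @` C).
Proof.
move=> TK CC u uC.
have /choice[v Hv] : forall n, exists x, C x /\ T x = u n.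
  by move=> n; have [x Cx <-] := uC n; exists x.
have [phi phi_lt vphi] := CC v (fun n => (Hv n).1).
exists phi => //; rewrite (_ : u \o phi = T \o (v \o phi)).
  exact: weakly_cauchy_image TK vphi.
by apply/funext => n /=; rewrite (Hv _).2.
Qed.

Lemma cwc_add V (C D : set V) :
  cond_weakly_compact C -> cond_weakly_compact D ->
  cond_weakly_compact [set x + y | x in C & y in D].
Proof.
move=> CC CD u uC.
have /choice[v Hv] : forall n, exists x, [/\ C x.1, D x.2 & x.1 + x.2 = u n].
  by move=> n; have [x Cx [y Dy <-]] := uC n; exists (x, y).
have [|phi phi_lt vphi] := CC (fun n => (v n).1); first by move=> n; case: (Hv n).
have [|psi psi_lt vpsi] := CD (fun n => (v (phi n)).2).
  by move=> n; case: (Hv (phi n)).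
exists (phi \o psi) => [m n mn|]; first exact/phi_lt/psi_lt.
rewrite (_ : u \o _ = fun n => (v (phi (psi n))).1 + (v (phi (psi n))).2).
  apply: weakly_cauchy_add vpsi.
  exact: weakly_cauchy_subsequence psi_lt vphi.
by apply/funext => n /=; case: (Hv (phi (psi n))).
Qed.

Lemma cwc_set0 V : cond_weakly_compact (set0 : set V).
Proof. by move=> u /(_ 0%N). Qed.

(** The partial sums of sum_j s_j 3^-j g_j, where the sign s_j is chosen so that
the j-th term does not cancel the value at u_j of the sum of the previous
terms. *)
Fixpoint humps V (g : nat -> V -> R^o) (u : nat -> V) (k : nat) (z : V) : R^o :=
  if k is j.+1 then
    humps g u j z + (if 0 <= humps g u j (u j) then 3^-1 ^+ j else - 3^-1 ^+ j) * g j z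
  else 0.

Lemma sum_pow3 n N : \sum_(n <= k < N) (3^-1 ^+ k : R) <= 3 / 2 * 3^-1 ^+ n.
Proof.
have [nN|Nn] := leqP n N; last first.
  by rewrite big_geq 1?ltnW// mulr_ge0// ?exprn_ge0// divr_ge0.
suff -> : \sum_(n <= k < N) (3^-1 ^+ k : R) = 3 / 2 * (3^-1 ^+ n - 3^-1 ^+ N).
  by rewrite ler_wpM2l// ?divr_ge0// lerBlDr lerDl exprn_ge0.
elim: N nN => [|N ih nN].
  by rewrite leqn0 => /eqP ->; rewrite big_geq// subrr mulr0.
move: nN; rewrite leq_eqVlt => /predU1P[->|nN]; first by rewrite big_geq// subrr mulr0.
rewrite big_nat_recr//= ih// exprSr; by field.
Qed.

(** A gliding hump.  If C is unbounded, it contains a weakly Cauchy sequence v with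
|v k| >= 2 k 3^k.  Let g_k norm v k and let f = sum_j s_j 3^-j g_j with the
signs of [humps].  The terms up to k contribute at least 3^-k |v k| to f (v k)
in absolute value and the others at most half of that, so |f (v k)| >= k,
although f (v k) converges. *)
Lemma cwc_bounded V (C : set V) :
  cond_weakly_compact C -> exists M, forall z, C z -> `|z| <= M.
Proof.
move=> CC; apply: contrapT => nC.
have /choice[u Hu] : forall k, exists z, C z /\ 2 * k%:R * 3 ^+ k <= `|z|.
  move=> k; apply: contrapT => Hk; apply: nC; exists (2 * k%:R * 3 ^+ k) => z Cz.
  by rewrite leNgt; apply/negP => h; apply: Hk; exists z; split => //; exact: ltW.
have [phi phi_lt uphi] := CC u (fun k => (Hu k).1).
pose v := u \o phi.
have vge k : 2 * k%:R * 3 ^+ k <= `|v k|.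
  apply: le_trans (Hu (phi k)).2; have le := homo_ltn_ge phi_lt k.
  rewrite ler_pM ?mulr_ge0 ?exprn_ge0// ?ler_wpM2l ?ler_nat//.
  by rewrite ler_weXn2l// ler1n.
have /choice[g Hg] : forall k, exists g : V -> R^o, bounded_op 1 g /\ g (v k) = `|v k|.
  by move=> k; have [g] := norming_bounded_op (v k); exists g.
pose psi k z : R^o :=
  (if 0 <= humps g v k (v k) then 3^-1 ^+ k else - 3^-1 ^+ k) * g k z.
have humpsE k z : humps g v k z = \sum_(0 <= j < k) psi j z.
  by elim: k => [|k ih]; rewrite ?big_nil// big_nat_recr//= ih.
have psiK k :
    bounded_op (`|if 0 <= humps g v k (v k) then 3^-1 ^+ k else - 3^-1 ^+ k| * 1)
      (psi k).
  by apply: bounded_op_scale; case: (Hg k).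
have psile k z : `|psi k z| <= 3^-1 ^+ k * `|z|.
  apply: (le_trans (bounded_op_le (psiK k) z)).
  by rewrite mulr1 ler_wpM2r//; case: ifP => _; rewrite ?normrN ger0_norm// exprn_ge0.
have psisum n N z : \sum_(n <= k < N) `|psi k z| <= (3 / 2 * 3^-1 ^+ n) * `|z|.
  apply: (@le_trans _ _ (\sum_(n <= k < N) 3^-1 ^+ k * `|z|)); first exact: ler_sum.
  by rewrite -mulr_suml ler_wpM2r// sum_pow3.
have [|k||f fK Hf] := @sum_functionals _ V psi (3 / 2).
- by rewrite divr_ge0.
- by eexists; exact: psiK.
- by move=> z N; have := psisum 0%N N z; rewrite expr0 mulr1.
have fge k : k%:R <= `|f (v k)|.
  have := Hf (v k) k.+1 _ (fun N => psisum k.+1 N (v k)).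
  rewrite big_nat_recr//= -humpsE.
  have : 3^-1 ^+ k * `|v k| <= `|humps g v k (v k) + psi k (v k)|.
    rewrite /psi (Hg k).2; have := normr_ge0 (v k).
    have : 0 <= (3^-1 ^+ k : R) by rewrite exprn_ge0.
    set t := 3^-1 ^+ k; set w := `|v k| => t0 w0.
    have tw0 := mulr_ge0 t0 w0.
    case: ifPn => [h0|]; first by rewrite ger0_norm; [lra|rewrite addr_ge0].
    rewrite -ltNge => h0; rewrite mulNr ler0_norm; lra.
  have : k%:R * 2 <= 3^-1 ^+ k * `|v k|.
    rewrite -ler_pdivrMl ?exprn_gt0 ?invr_gt0//.
    by rewrite exprVn invrK mulrC [k%:R * 2]mulrC; exact: vge.
  set s := humps _ _ _ _ + _ => h1 h2; rewrite exprSr => h3.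
  have := ler_normB (s - f (v k)) (- f (v k)).
  rewrite opprK subrK normrN distrC => h4.
  set t := (3^-1 ^+ k : R) in h1 h2 h3; lra.
have /weakly_cauchyP /(_ _ _ fK 1 ltr01) [N HN] := uphi.
pose n := maxn N (Num.trunc (`|f (v N)| + 1)).+1.
have /HN /(_ (leqnn N)) : (N <= n)%N by rewrite leq_maxl.
rewrite -/(v n) => h.
have : `|f (v N)| + 1 < n%:R.
  apply: (lt_le_trans (truncnS_gt _)).
  by rewrite ler_nat leq_maxr.
have := fge n.
have := ler_normD (f (v n) - f (v N)) (f (v N)); rewrite subrK.
move: h; rewrite /v /=; lra.
Qed.

Lemma sum_subsequence_bound V (psi : nat -> V -> R^o) (M : R) phi :
  {homo phi : m n / (m < n)%N} ->
  (forall z N, \sum_(0 <= k < N) `|psi k z| <= M * `|z|) ->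
  forall z N, \sum_(0 <= k < N) `|psi (phi k) z| <= M * `|z|.
Proof.
move=> phi_lt psiM z N.
apply: (le_trans (@sum_subsequence_le _ (fun k => `|psi k z|) phi 0 N _ phi_lt)) => //.
apply: le_trans (psiM z (phi N)).
by rewrite [leRHS](big_cat_nat (n := phi 0))//= ?lerDr ?sumr_ge0// (ltnW_homo phi_lt).
Qed.

(** Along a sparse subsequence phi, the terms psi (phi i) with i < n are small
at w (phi n) because w is weakly null, and those with i > n are small because
the series converges absolutely at w (phi n).  The functional
sum_i psi (phi i) is then dominated at w (phi n) by its n-th term, which
stays away from 0: this contradicts weak nullity. *)
Lemma weakly_null_gliding_hump V (psi : nat -> V -> R^o) (M : R) (w : nat -> V) (e : R) :
  0 <= M -> (forall k, exists K, bounded_op K (psi k)) ->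
  (forall z N, \sum_(0 <= k < N) `|psi k z| <= M * `|z|) ->
  (forall K (f : V -> R^o), bounded_op K f -> forall d, 0 < d ->
    exists N, forall n, (N <= n)%N -> `|f (w n)| < d) ->
  0 < e -> ~ (forall k, e <= `|psi k (w k)|).
Proof.
move=> M0 psiK psiM w0 e0 He.
have e40 : 0 < e / 4 by rewrite divr_gt0.
have head n d : 0 < d -> exists N, forall m, (N <= m)%N ->
    \sum_(0 <= k < n) `|psi k (w m)| <= d.
  elim: n d => [|n ih] d d0.
    by exists 0%N => m _; rewrite big_nil ltW.
  have d20 : 0 < d / 2 by rewrite divr_gt0.
  have [N HN] := ih _ d20; have [K fK] := psiK n; have [N' HN'] := w0 _ _ fK _ d20.
  exists (maxn N N') => m; rewrite geq_max => /andP[/HN h1 /HN' h2].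
  by rewrite big_nat_recr//= [leRHS](splitr d) lerD// ltW.
have [|phi phi_lt Hphi] := @dependent_subsequence (fun j j' =>
    \sum_(0 <= k < j.+1) `|psi k (w j')| <= e / 4 /\
    forall N, \sum_(j' <= k < N) `|psi k (w j)| <= e / 4).
  move=> j; have [N1 H1] := head j.+1 _ e40.
  have [N2 H2] := @summable_tail _ (fun k => `|psi k (w j)|) _
    (fun k => normr_ge0 _) (psiM (w j)) _ e40.
  exists (maxn j.+1 (maxn N1 N2)); first by rewrite leq_maxl.
  split; first by apply: H1; rewrite !leq_max leqnn orbT.
  move=> N; apply: le_trans (H2 N).
  have [le|lt] := leqP (maxn j.+1 (maxn N1 N2)) N; last first.
    by rewrite big_geq 1?ltnW// sumr_ge0.
  rewrite [leRHS](big_cat_nat (n := maxn j.+1 (maxn N1 N2)))//= ?lerDr ?sumr_ge0//.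
  by rewrite !leq_max leqnn !orbT.
pose psi' k := psi (phi k).
have psi'M := sum_subsequence_bound phi_lt psiM.
have [f fM Hf] := sum_functionals M0 (fun k => psiK (phi k)) psi'M.
have [N HN] := w0 _ _ fM _ e40.
pose n := N.+1.
have Nphi : (N <= phi n)%N by apply: leq_trans (homo_ltn_ge phi_lt _); exact: leqnSn.
have := HN _ Nphi.
have [Hhead _] := Hphi N; have [_ Htail] := Hphi n.
have h1 : `|\sum_(0 <= k < n) psi' k (w (phi n))| <= e / 4.
  apply: (le_trans (ler_norm_sum _ _ _)); apply: le_trans Hhead.
  rewrite -/n !big_nat_recr//= lerD2r.
  apply: (le_trans (@sum_subsequence_le _ (fun k => `|psi k (w (phi n))|)
    phi 0 N _ phi_lt)) => //.
  by rewrite [leRHS](big_cat_nat (n := phi 0))//= ?lerDr ?sumr_ge0// (ltnW_homo phi_lt).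
have := Hf (w (phi n)) n.+1 (e / 4); rewrite big_nat_recr//= => h2.
have {}h2 := h2 (fun N' => le_trans
  (@sum_subsequence_le _ (fun k => `|psi k (w (phi n))|) phi n.+1 N'
    (fun=> normr_ge0 _) phi_lt) (Htail _)).
have := He (phi n).
set a := psi (phi n) _ in h2 *; set A := \sum_(0 <= k < n) _ in h1 h2.
set y := f _ in h2 * => ha hy.
have := ler_normB (y - A) (y - (A + a)); rewrite (_ : _ - _ = a); last by ring.
have := ler_normB y A; lra.
Qed.

(** The Schur property of l^1, for the operator z |-> (psi k z)_k into l^1.
After passing to a weakly Cauchy subsequence one takes differences of
consecutive terms along a further subsequence, sparse enough for the subtracted
term to be negligible in the relevant coordinate; these differences are weakly
null. *)
Lemma schur_diagonal V (psi : nat -> V -> R^o) (M : R) C (u : nat -> V) (e : R) :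
  0 <= M -> (forall k, exists K, bounded_op K (psi k)) ->
  (forall z N, \sum_(0 <= k < N) `|psi k z| <= M * `|z|) ->
  cond_weakly_compact C -> (forall k, C (u k)) ->
  0 < e -> ~ (forall k, e <= `|psi k (u k)|).
Proof.
move=> M0 psiK psiM CC uC e0 He.
have [phi phi_lt /weakly_cauchyP vC] := CC u uC.
have e20 : 0 < e / 2 by rewrite divr_gt0.
have [|chi chi_lt Hchi] := @dependent_subsequence
    (fun m m' => `|psi (phi m') (u (phi m))| <= e / 2).
  move=> m.
  have [n Hn] := @summable_tail _ (fun k => `|psi k (u (phi m))|) _
    (fun k => normr_ge0 _) (psiM (u (phi m))) _ e20.
  exists (maxn n m.+1); first by rewrite leq_maxr.
  set m' := maxn _ _; have nm' : (n <= phi m')%N.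
    by apply: leq_trans (homo_ltn_ge phi_lt m'); rewrite leq_maxl.
  apply: le_trans (Hn (phi m').+1).
  by rewrite big_nat_recr//= lerDr sumr_ge0.
pose theta k := phi (chi k.+1).
have theta_lt : {homo theta : m n / (m < n)%N} by move=> m n mn; exact/phi_lt/chi_lt.
apply: (@weakly_null_gliding_hump _ (fun k => psi (theta k)) M
    (fun k => u (phi (chi k.+1)) - u (phi (chi k))) (e / 2)) => //.
- exact: sum_subsequence_bound.
- move=> K f fK d d0; have [N HN] := vC K f fK d d0; exists N => n Nn.
  have Nc k : (N <= k -> N <= chi k)%N by move=> Nk; exact: leq_trans (homo_ltn_ge chi_lt k).
  by rewrite (bounded_opB fK); apply: HN; apply: Nc => //; exact: leqW.
move=> k; have [K fK] := psiK (theta k).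
rewrite (bounded_opB fK); have := Hchi k; rewrite -/(theta k).
have := He (theta k).
have := lerB_dist (psi (theta k) (u (theta k))) (psi (theta k) (u (phi (chi k)))).
lra.
Qed.

End weakly_cauchy.

(** * Approximation by countably many conditionally weakly compact sets *)

Section cwc_approximable.
Context {R : realType}.
Implicit Types U V W : completeNormedModType R.

(** The images under T of conditionally weakly compact sets, up to a small
error, are covered by members of one countable family that depends on T
only.  The identity has this property exactly when the space is SCWCG
([SCWCG_cwc_approximable] and [cwc_approximable_SCWCG]), and the property is
stable under sums, compositions and approximation, which is what allows the
identity of the tensor product to be treated piece by piece. *)
Definition cwc_approximable V W (T : V -> W) : Prop :=
  exists2 G : nat -> set W, forall n, cond_weakly_compact (G n) &
    forall C : set V, cond_weakly_compact C -> forall e : R, 0 < e ->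
      exists n, forall z, C z -> exists2 g, G n g & `|T z - g| <= e.

Lemma cwc_approximable_countable V W (T : V -> W) (I : countType) (G : I -> set W) :
  (forall i, cond_weakly_compact (G i)) ->
  (forall C : set V, cond_weakly_compact C -> forall e : R, 0 < e ->
      exists i, forall z, C z -> exists2 g, G i g & `|T z - g| <= e) ->
  cwc_approximable T.
Proof.
move=> GC HG; exists (fun n => if choice.unpickle n is Some i then G i else set0).
  by move=> n; case: (choice.unpickle n) => // ; exact: cwc_set0.
move=> C CC e e0; have [i Hi] := HG C CC e e0.
by exists (choice.pickle i); rewrite choice.pickleK.
Qed.

Lemma cwc_approximable_comp U V W K (T : V -> W) (S : U -> V) :
  bounded_op K S -> cwc_approximable T -> cwc_approximable (T \o S).
Proof.
move=> SK [G GC HG]; exists G => // C CC e e0.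
have [n Hn] := HG _ (cwc_image SK CC) e e0.
by exists n => z Cz; apply: Hn; exists z.
Qed.

Lemma cwc_approximable_comp_left U V W K (T : V -> W) (S : U -> V) :
  bounded_op K T -> cwc_approximable S -> cwc_approximable (T \o S).
Proof.
move=> TK [G GC HG]; exists (fun n => T @` G n); first by move=> n; exact: cwc_image TK _.
have K0 := bounded_op_ge0 TK.
move=> C CC e e0; have d0 : 0 < e / (K + 1) by rewrite divr_gt0// ltr_wpDl.
have [n Hn] := HG C CC _ d0; exists n => z /Hn[g Gg Hg].
exists (T g); first by exists g.
rewrite /= -(bounded_opB TK) (le_trans (bounded_op_le TK _))//.
apply: (le_trans (ler_wpM2l K0 Hg)).
by rewrite mulrA ler_pdivrMr ?ltr_wpDl// mulrC ler_wpM2l ?lerDl// ltW.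
Qed.

Lemma cwc_approximable_add V W (S T : V -> W) :
  cwc_approximable S -> cwc_approximable T -> cwc_approximable (fun z => S z + T z).
Proof.
move=> [G GC HG] [H HC HH].
apply: (@cwc_approximable_countable _ _ _ (nat * nat)%type
    (fun i => [set x + y | x in G i.1 & y in H i.2])) => [i|C CC e e0].
  exact: cwc_add.
have e20 : 0 < e / 2 by rewrite divr_gt0.
have [n Hn] := HG C CC _ e20; have [m Hm] := HH C CC _ e20.
exists (n, m) => z Cz; have [g Gg gz] := Hn z Cz; have [h Hh hz] := Hm z Cz.
exists (g + h); first by exists g => //; exists h.
by rewrite opprD addrACA [leRHS]splitr (le_trans (ler_normD _ _))// lerD.
Qed.

Lemma cwc_approximable_zero V W : cwc_approximable (fun _ : V => 0 : W).
Proof.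
exists (fun=> [set 0]) => [_ u u0|C _ e e0].
  exists id => //; apply: norm_null_weakly_cauchy => e e0; exists 0%N => n _.
  by rewrite /= u0 normr0 ltW.
by exists 0%N => z _; exists 0 => //; rewrite subrr normr0 ltW.
Qed.

(** The index n may depend on C and e: the countable families of the
operators T n are simply united. *)
Lemma cwc_approximable_limit V W (S : V -> W) (T : nat -> V -> W) :
  (forall n, cwc_approximable (T n)) ->
  (forall C : set V, cond_weakly_compact C -> forall e : R, 0 < e ->
    exists n, forall z, C z -> `|S z - T n z| <= e) -> cwc_approximable S.
Proof.
move=> TT TS; have /choice[G HG] : forall n, exists G : nat -> set W,
    (forall m, cond_weakly_compact (G m)) /\
    forall C : set V, cond_weakly_compact C -> forall e : R, 0 < e ->
      exists m, forall z, C z -> exists2 g, G m g & `|T n z - g| <= e.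
  by move=> n; have [G GC HG] := TT n; exists G.
apply: (@cwc_approximable_countable _ _ _ (nat * nat)%type (fun i => G i.1 i.2)) => [i|C CC e e0].
  exact: (HG _).1.
have e20 : 0 < e / 2 by rewrite divr_gt0.
have [n Hn] := TS C CC _ e20; have [m Hm] := (HG n).2 C CC _ e20.
exists (n, m) => z Cz; have [g Gg gz] := Hm z Cz; exists g => //.
rewrite (_ : S z - g = (S z - T n z) + (T n z - g)); last by rewrite addrA subrK.
by rewrite [leRHS]splitr (le_trans (ler_normD _ _))// lerD// Hn.
Qed.

Lemma closed_unit_ballP V (x : V) : closed_ball 0 1 x <-> `|x| <= 1.
Proof. by rewrite closed_ballE// /closed_ball_/= sub0r normrN. Qed.

Lemma SCWCG_cwc_approximable V : SCWCG V -> cwc_approximable (@id V).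
Proof.
move=> [G GC HG]; exists (fun n => [set n%:R *: g | g in G]).
  by move=> n; apply: (@cwc_image _ V V) GC; apply: (bounded_op_scale n%:R (bounded_op_id V)).
move=> C CC e e0; have [n Hn] := HG C CC e e0.
exists n => z /Hn[g Gg [x /closed_unit_ballP x1 <-]].
exists (n%:R *: g); first by exists g.
by rewrite addrAC subrr add0r normrZ gtr0_norm// ler_piMr// ltW.
Qed.

(** A sequence in the union either meets one of the sets infinitely often, or
leaves every finite union of them and then tends to 0 in norm. *)
Lemma cwc_shrinking_union V (G : nat -> set V) :
  (forall n, cond_weakly_compact (G n)) ->
  (forall n z, G n z -> `|z| <= n.+1%:R^-1) ->
  cond_weakly_compact (\bigcup_n G n).
Proof.
move=> GC G1 u uG.
have /choice[idx Hidx] : forall k, exists n, G n (u k).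
  by move=> k; have [n _] := uG k; exists n.
have [[n Hn]|Hfin] := pselect (exists n, forall N, exists2 k, (N <= k)%N & idx k = n).
  have [phi phi_lt Hphi] := frequent_subsequence Hn.
  have [|psi psi_lt Hpsi] := GC n (u \o phi).
    by move=> k; have := Hidx (phi k); rewrite Hphi.
  by exists (phi \o psi) => // i j ij; exact/phi_lt/psi_lt.
have leaves n : exists N, forall k, (N <= k)%N -> (n <= idx k)%N.
  elim: n => [|n [N HN]]; first by exists 0%N.
  have [M HM] : exists M, forall k, (M <= k)%N -> idx k <> n.
    apply: contrapT => nM; apply: Hfin; exists n => M; apply: contrapT => nk.
    by apply: nM; exists M => k Mk ik; apply: nk; exists k.
  exists (maxn N M) => k; rewrite geq_max => /andP[/HN nk /HM kn].
  by rewrite ltn_neqAle nk andbT eq_sym; apply/eqP.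
exists id => //; apply: norm_null_weakly_cauchy => e e0.
have [N HN] := leaves (Num.trunc e^-1); exists N => n /HN le.
apply: (le_trans (G1 _ _ (Hidx n))).
rewrite -[e]invrK lef_pV2 ?posrE ?invr_gt0 ?ltr0n//.
by rewrite (le_trans (ltW (truncnS_gt _)))// ler_nat ltnS.
Qed.

(** The members of the family are bounded, so they can be shrunk to make
their union conditionally weakly compact.  The shrinking factors are inverses
of natural numbers, so that a natural multiple of the union contains the
original set. *)
Lemma cwc_approximable_SCWCG V : cwc_approximable (@id V) -> SCWCG V.
Proof.
move=> [G GC HG].
have /choice[m Hm] : forall n, exists m : nat, (0 < m)%N /\ forall z, G n z -> `|z| <= m%:R.
  move=> n; have [M HM] := cwc_bounded (GC n).
  exists (Num.trunc M).+1; split=> // z /HM zM.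
  exact: le_trans (ltW (truncnS_gt _)).
pose c n : nat := (n.+1 * m n)%N.
have c0 n : (c n)%:R != 0 :> R by rewrite pnatr_eq0 -lt0n muln_gt0 (Hm n).1.
exists (\bigcup_n [set (c n)%:R^-1 *: g | g in G n]).
  apply: cwc_shrinking_union => [n|n _ [g Gg <-]].
    by apply: (@cwc_image _ V V) (GC n); apply: (bounded_op_scale _ (bounded_op_id V)).
  have m0 : 0 < (m n)%:R :> R by rewrite ltr0n (Hm n).1.
  rewrite normrZ normfV normr_nat natrM invfM -mulrA ler_piMr ?invr_ge0//.
  by rewrite mulrC ler_pdivrMr// mul1r (Hm n).2.
move=> C CC e e0; have [n Hn] := HG C CC e e0.
exists (c n) => z /Hn[g Gg gz]; exists ((c n)%:R^-1 *: g); first by exists n => //; exists g.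
exists (e^-1 *: (z - g)).
  apply/closed_unit_ballP; rewrite normrZ normfV gtr0_norm// mulrC ler_pdivrMr//.
  by rewrite mul1r.
rewrite !scalerA divff; last exact: c0.
by rewrite divff ?gt_eqF// !scale1r addrC subrK.
Qed.

End cwc_approximable.

(** * Operators on a projective tensor product *)

Section tensor.
Context {R : realType} {X Y : completeNormedModType R}.
Implicit Types (s t : seq (X * Y)) (V W : completeNormedModType R).

Definition bounded_bilinear W (K : R) (B : X -> Y -> W) : Prop :=
  [/\ 0 <= K, forall y a u v, B (a *: u + v) y = a *: B u y + B v y,
      forall x a u v, B x (a *: u + v) = a *: B x u + B x v &
      forall x y, `|B x y| <= K * (`|x| * `|y|)].

Definition tensor_sum W (B : X -> Y -> W) s : W := \sum_(w <- s) B w.1 w.2.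

Lemma tensor_sum_cat W (B : X -> Y -> W) s t :
  tensor_sum B (s ++ t) = tensor_sum B s + tensor_sum B t.
Proof. exact: big_cat. Qed.

Lemma tensor_sum_scale W K (B : X -> Y -> W) a s : bounded_bilinear K B ->
  tensor_sum B [seq (a *: w.1, w.2) | w <- s] = a *: tensor_sum B s.
Proof.
move=> [_ Bl _ _]; rewrite /tensor_sum big_map scaler_sumr; apply: eq_bigr => w _ /=.
have B0 : B 0 w.2 = 0.
  by have := Bl w.2 (-1) 0 0; rewrite scaler0 addr0 scaleN1r addNr.
by have := Bl w.2 a w.1 0; rewrite addr0 B0 addr0.
Qed.

Lemma tensor_eq_sum W K (B : X -> Y -> W) s t : bounded_bilinear K B ->
  tensor_eq s t -> tensor_sum B s = tensor_sum B t.
Proof.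
move=> [_ Bl Br _] st; apply: functionals_separate => f L fL.
pose B' x y : R^o := f (B x y).
have B'P : bilinear_for (GRing.Scale.Law.clone _ _ *:%R _)
    (GRing.Scale.Law.clone _ _ *:%R _) B'.
  split=> [y|x] a u v; rewrite /B' /=.
    by rewrite Bl (bounded_opP fL).
  by rewrite Br (bounded_opP fL).
pose fB := bilinear_isBilinear.Build R X Y R^o _ _ B' B'P.
pose g : {bilinear X -> Y -> R^o} := HB.pack B' fB.
by rewrite /tensor_sum !(bounded_op_sum fL); exact: (st g).
Qed.

(** The factor K is kept on the right because it may vanish. *)
Lemma le_projective_norm s (K c : R) : 0 <= K ->
  (forall t, tensor_eq s t -> c <= K * \sum_(w <- t) `|w.1| * `|w.2|) ->
  c <= K * projective_norm s.
Proof.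
rewrite le_eqVlt => /predU1P[<-|K0] H.
  by have := H s (fun=> erefl); rewrite !mul0r.
rewrite -ler_pdivrMl//; apply: lb_le_inf.
  by exists (\sum_(w <- s) `|w.1| * `|w.2|); exists s.
by move=> _ [t st <-]; rewrite ler_pdivrMl//; exact: H.
Qed.

Context {Z : completeNormedModType R} (b : {bilinear X -> Y -> Z}).
Hypothesis hZ : is_projective_tensor b.

Lemma norm_tensor_le x y : `|b x y| <= `|x| * `|y|.
Proof.
have := hZ.1 [:: (x, y)]; rewrite big_seq1 /= => ->.
apply: ge_inf; first by exists 0 => _ [t _ <-]; apply: sumr_ge0 => w _; exact: mulr_ge0.
by exists [:: (x, y)]; rewrite ?big_seq1.
Qed.

Lemma bounded_bilinear_tensor : bounded_bilinear 1 b.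
Proof.
split=> // [y a u v|x a u v|x y]; first by rewrite linearPl.
  by rewrite linearPr.
by rewrite mul1r norm_tensor_le.
Qed.

Lemma tensor_sum_dense z (e : R) : 0 < e -> exists s, `|z - tensor_sum b s| < e.
Proof.
move=> e0; have [|w [ze [s _ sw]]] := hZ.2 (ball z e) _ (ball_open z e).
  by exists z; exact: ballxx.
by exists s; move: ze; rewrite -sw -ball_normE.
Qed.

Lemma norm_tensor_sum_le W K (B : X -> Y -> W) s : bounded_bilinear K B ->
  `|tensor_sum B s| <= K * `|tensor_sum b s|.
Proof.
move=> BK; rewrite (hZ.1 s); apply: le_projective_norm; first by case: BK.
move=> t st; rewrite (tensor_eq_sum BK st) (le_trans (ler_norm_sum _ _ _))//.
by rewrite mulr_sumr ler_sum// => w _; case: BK.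
Qed.

(** The universal property.  The norm of a finite sum of elementary tensors
is its projective norm, so the map sending the sum of b over s to the sum of B
over s is K-Lipschitz, and it extends from this dense subspace; F z is
characterised by its distances to the values on the subspace. *)
Lemma tensor_extension W K (B : X -> Y -> W) : bounded_bilinear K B ->
  exists2 F : Z -> W, bounded_op K F & forall x y, F (b x y) = B x y.
Proof.
move=> BK; have K0 : 0 <= K by case: BK.
have lin a s t : exists r, tensor_sum b r = a *: tensor_sum b s + tensor_sum b t /\
    tensor_sum B r = a *: tensor_sum B s + tensor_sum B t.
  exists ([seq (a *: w.1, w.2) | w <- s] ++ t); rewrite !tensor_sum_cat.
  by rewrite (tensor_sum_scale a s bounded_bilinear_tensor) (tensor_sum_scale a s BK).
have lip s t : `|tensor_sum B s - tensor_sum B t| <= K * `|tensor_sum b s - tensor_sum b t|.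
  have [r [rb rB]] := lin (-1) t s.
  have := norm_tensor_sum_le r BK; rewrite rb rB !scaleN1r.
  by rewrite addrC [X in K * `|X|]addrC.
have small e : 0 < e -> exists2 d, 0 < d & K * d <= e.
  move=> e0; exists (e / (K + 1)); first by rewrite divr_gt0// ltr_wpDl.
  by rewrite mulrA ler_pdivrMr ?ltr_wpDl// mulrC ler_wpM2l ?lerDl// ltW.
have /choice[F FE] : forall z, exists w, forall s,
    `|w - tensor_sum B s| <= K * `|z - tensor_sum b s|.
  move=> z; have /choice[s Hs] : forall n : nat, exists s, `|z - tensor_sum b s| < n.+1%:R^-1.
    by move=> n; apply: tensor_sum_dense; rewrite invr_gt0.
  have near e : 0 < e -> exists N, forall n, (N <= n)%N -> `|z - tensor_sum b (s n)| < e.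
    move=> e0; exists (Num.trunc e^-1) => n le; apply: (lt_trans (Hs n)).
    rewrite -[ltRHS]invrK ltf_pV2 ?posrE ?invr_gt0 ?ltr0n//.
    by rewrite (lt_le_trans (truncnS_gt _))// ler_nat ltnS.
  have [|w Hw] := @cauchy_limit _ W (fun n => tensor_sum B (s n)).
    move=> e e0; have e20 : 0 < e / 2 by rewrite divr_gt0.
    have [d d0 Kd] := small _ e20; have d20 : 0 < d / 2 by rewrite divr_gt0.
    have [N HN] := near _ d20; exists N => m n /HN zm /HN zn.
    apply: (le_lt_trans (lip _ _)); apply: (@le_lt_trans _ _ (e / 2)); last by lra.
    apply: le_trans Kd; rewrite ler_wpM2l//.
    rewrite [leRHS]splitr -(subrKA z) (le_trans (ler_normD _ _))// lerD// ltW//.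
    by rewrite distrC.
  exists w => t; apply/ler_addgt0Pl => e e0.
  have e20 : 0 < e / 2 by rewrite divr_gt0.
  have [d d0 Kd] := small _ e20; have [N HN] := near _ d0; have [M HM] := Hw _ e20.
  pose n := maxn N M.
  have /HN zn : (N <= n)%N by rewrite leq_maxl.
  have /HM wn : (M <= n)%N by rewrite leq_maxr.
  rewrite -(subrKA (tensor_sum B (s n))) (le_trans (ler_normD _ _))//.
  have := lip (s n) t; move: wn; rewrite distrC.
  have : `|tensor_sum b (s n) - tensor_sum b t| <= d + `|z - tensor_sum b t|.
    rewrite -(subrKA z) (le_trans (ler_normD _ _))// lerD//.
    by rewrite distrC ltW.
  move=> /(ler_wpM2l K0); rewrite mulrDr; lra.
exists F; last first.
  move=> x y; apply/eqP; rewrite -subr_eq0 -normr_le0.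
  have := FE (b x y) [:: (x, y)]; rewrite /tensor_sum !big_seq1/=.
  by rewrite subrr normr0 mulr0.
split=> // [a x y|z]; last first.
  by have := FE z [::]; rewrite /tensor_sum !big_nil !subr0.
apply/eqP; rewrite -subr_eq0 -normr_le0; apply/ler_addgt0Pl => e e0; rewrite addr0.
have [d d0 Kd] := small _ e0.
have a2 : 0 < 2 * `|a| + 2 by rewrite ltr_wpDl// mulr_ge0.
have d'0 : 0 < d / (2 * `|a| + 2) by rewrite divr_gt0.
have [s Hs] := tensor_sum_dense x d'0; have [t Ht] := tensor_sum_dense y d'0.
have [r [rb rB]] := lin a s t.
have := FE (a *: x + y) r; have := FE x s; have := FE y t.
rewrite rb rB.
set x' := tensor_sum b s in Hs *; set y' := tensor_sum b t in Ht *.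
set X' := tensor_sum B s; set Y' := tensor_sum B t => h1 h2 h3.
have h2' := ler_wpM2l (normr_ge0 a) h2.
rewrite (_ : _ - _ = (F (a *: x + y) - (a *: X' + Y')) -
  (a *: (F x - X') + (F y - Y'))); last first.
  by rewrite scalerBr addrACA -opprD opprB addrA subrK.
rewrite (le_trans (ler_normB _ _))//.
apply: le_trans (_ : K * d <= e) => //.
have h4 : `|a *: (F x - X') + (F y - Y')| <= `|a| * (K * `|x - x'|) + K * `|y - y'|.
  by rewrite (le_trans (ler_normD _ _))// normrZ lerD.
have h5 : `|a *: x + y - (a *: x' + y')| <= `|a| * `|x - x'| + `|y - y'|.
  by rewrite opprD addrACA -scalerBr (le_trans (ler_normD _ _))// normrZ.
have := ler_wpM2l K0 h5.
have h6 : K * (2 * (`|a| * `|x - x'| + `|y - y'|)) <= K * d.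
  rewrite ler_wpM2l//.
  have := ler_wpM2l (normr_ge0 a) (ltW Hs).
  have : d = (2 * `|a| + 2) * (d / (2 * `|a| + 2)) by rewrite mulrC divfK ?gt_eqF.
  move: Ht; lra.
move: h3 h4 h6; lra.
Qed.

(** The unit ball of the projective tensor product is the closed convex hull
of the elementary tensors of norm at most 1. *)
Lemma bounded_op_tensor W K L (F : Z -> W) : bounded_op L F -> 0 <= K ->
  (forall x y, `|F (b x y)| <= K * (`|x| * `|y|)) -> bounded_op K F.
Proof.
move=> FL K0 FK; split=> // [|z]; first exact: bounded_opP FL.
have L0 := bounded_op_ge0 FL.
have FB : bounded_bilinear K (fun x y => F (b x y)).
  split=> // [y a u v|x a u v].
    by rewrite linearPl (bounded_opP FL).
  by rewrite linearPr (bounded_opP FL).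
have Fs s : `|F (tensor_sum b s)| <= K * `|tensor_sum b s|.
  by rewrite /tensor_sum (bounded_op_sum FL); exact: norm_tensor_sum_le s FB.
apply/ler_addgt0Pl => e e0.
have d0 : 0 < e / (K + L + 1) by rewrite divr_gt0// ltr_wpDl// addr_ge0.
have [s Hs] := tensor_sum_dense z d0.
have : `|F z| <= `|F (z - tensor_sum b s)| + `|F (tensor_sum b s)|.
  by rewrite (bounded_opB FL) -{1}[F z](subrK (F (tensor_sum b s))) ler_normD.
have := bounded_op_le FL (z - tensor_sum b s).
have := ler_wpM2l L0 (ltW Hs); have := ler_wpM2l K0 (ltW Hs).
have : `|tensor_sum b s| <= `|z| + `|z - tensor_sum b s|.
  by rewrite -{1}(subKr z (tensor_sum b s)) ler_normB.
move=> /(ler_wpM2l K0); have := Fs s.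
have : e = K * (e / (K + L + 1)) + L * (e / (K + L + 1)) + e / (K + L + 1).
  by field; rewrite gt_eqF// ltr_wpDl// addr_ge0.
set d := e / _ in d0 *; rewrite mulrDr.
have := ler_wpM2l K0 (ltW Hs).
lra.
Qed.

End tensor.

(** * Projections of a finite-dimensional decomposition *)

Section finite_rank.
Context {R : realType}.
Implicit Types V W : normedModType R.

Inductive finite_rank V W : (V -> W) -> Prop :=
| finite_rank_zero : finite_rank (fun=> 0)
| finite_rank_cons K (f : V -> R^o) (w : W) (T : V -> W) :
    bounded_op K f -> finite_rank T -> finite_rank (fun x => f x *: w + T x).

Lemma finite_rank_add V W (S T : V -> W) :
  finite_rank S -> finite_rank T -> finite_rank (fun x => S x + T x).
Proof.
elim=> [|K f w S' fK S'r ih] Tr.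
  by rewrite (_ : (fun _ => _) = T)//; apply/funext => x; rewrite add0r.
rewrite (_ : (fun _ => _) = fun x => f x *: w + (S' x + T x)).
  by apply: finite_rank_cons fK (ih Tr).
by apply/funext => x; rewrite addrA.
Qed.

Lemma finite_rank_sum V W (I : Type) (r : seq I) (T : I -> V -> W) :
  (forall i, finite_rank (T i)) -> finite_rank (fun x => \sum_(i <- r) T i x).
Proof.
move=> Tr; elim: r => [|i r ih].
  rewrite (_ : (fun _ => _) = fun=> 0); first exact: finite_rank_zero.
  by apply/funext => x; rewrite big_nil.
rewrite (_ : (fun _ => _) = fun x => T i x + \sum_(i <- r) T i x).
  exact: finite_rank_add.
by apply/funext => x; rewrite big_cons.
Qed.

(** Coordinates without bases: if T x0 <> 0, a functional g with
g (T x0) = 1 splits off the rank-one operator g (T x) T x0, and the remainder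
takes its values in the intersection of ker g with the span of the w k.
Eliminating one w j with g (w j) <> 0 shows that n - 1 vectors span it, so
induction applies, and all coefficients are bounded functionals by
construction. *)
Lemma finite_dim_range V W n K (T : V -> W) (w : 'I_n -> W) :
  bounded_op K T ->
  (forall x, exists a : 'I_n -> R, T x = \sum_(k < n) a k *: w k) ->
  finite_rank T.
Proof.
elim: n K T w => [|n ih] K T w TK Tw.
  rewrite (_ : T = fun=> 0); first exact: finite_rank_zero.
  by apply/funext => x; have [a ->] := Tw x; rewrite big_ord0.
have [T0|] := pselect (forall x, T x = 0).
  rewrite (_ : T = fun=> 0); first exact: finite_rank_zero.
  exact/funext.
move=> /existsNP[x0 /eqP Tx0].
(* a functional normalised to take the value 1 at T x0 *)
have [h h1 hT] := norming_bounded_op (T x0).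
pose c := `|T x0|^-1.
have c1 : c * `|T x0| = 1 by rewrite mulVf// normr_eq0.
pose g z : R^o := c *: h z.
have gK : bounded_op (`|c| * 1) g := bounded_op_scale c h1.
have gT : g (T x0) = 1 by rewrite /g hT.
have [j gj] : exists j, g (w j) != 0.
  apply: contrapT => nj; have [a Ta] := Tw x0.
  move: gT; rewrite Ta (bounded_op_sum gK) big1 => [/eqP|k _].
    by rewrite eq_sym oner_eq0.
  rewrite (bounded_opZ gK); have [->|gk] := eqVneq (g (w k)) 0; first exact: scaler0.
  by case: nj; exists k.
pose S x := T x - g (T x) *: T x0.
have gTK := bounded_op_comp gK TK.
have SK : exists L, bounded_op L S.
  have sK : bounded_op (`|T x0|) (fun a : R^o => a *: T x0).
    split=> // [a x y|x]; first by rewrite scalerDl scalerA.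
    by rewrite normrZ mulrC.
  by eexists; apply: bounded_op_sub TK (bounded_op_comp sK gTK).
rewrite (_ : T = fun x => (g \o T) x *: T x0 + S x); last first.
  by apply/funext => x; rewrite /S /= addrC subrK.
apply: finite_rank_cons gTK _.
have [L SL] := SK.
apply: (ih L S (fun k => w (lift j k) - (g (w (lift j k)) / g (w j)) *: w j)) => // x.
have gS : g (S x) = 0.
  by rewrite /S (bounded_opB gK) (bounded_opZ gK) gT /GRing.scale/= mulr1 subrr.
have [a Sa] : exists a : 'I_n.+1 -> R, S x = \sum_(k < n.+1) a k *: w k.
  have [a Ta] := Tw x; have [d Td] := Tw x0; exists (fun k => a k - g (T x) * d k).
  rewrite /S {1}Ta Td scaler_sumr -sumrB; apply: eq_bigr => k _.
  by rewrite scalerBl scalerA.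
exists (fun k => a (lift j k)).
move: gS; rewrite Sa (bounded_op_sum gK) !(bigD1_ord j)//= (bounded_opZ gK) => gS.
under [RHS]eq_bigr do rewrite scalerBr scalerA.
rewrite sumrB -scaler_suml addrC; congr (_ + _); rewrite -scaleNr; congr (_ *: _).
apply: (mulIf gj); move: gS => /eqP; rewrite addr_eq0 => /eqP; rewrite {1}/GRing.scale/= => ->.
rewrite mulNr mulr_suml; congr (- _); apply: eq_bigr => k _.
by rewrite (bounded_opZ gK) -mulrA divfK.
Qed.

End finite_rank.

#[local] Existing Instance summability.totally_filter.

Section decomposition.
Context {R : realType} {X : completeNormedModType R} {I : choiceType}.
Variables (D : I -> set X) (hD : uncond_decomposition D).

Lemma decomp_proj_expansion x : expansion D x (fun i => decomp_proj D i x).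
Proof.
rewrite /decomp_proj; apply: xgetPex.
by have [u [ux _]] := hD.2 x; exists u.
Qed.

Lemma expansion_unique x u : expansion D x u -> u = (fun i => decomp_proj D i x).
Proof.
move=> ux; have [v [_ vuniq]] := hD.2 x.
by rewrite -(vuniq _ ux); apply: vuniq; exact: decomp_proj_expansion.
Qed.

Lemma decomp_proj_linear i a x y :
  decomp_proj D i (a *: x + y) = a *: decomp_proj D i x + decomp_proj D i y.
Proof.
have [xD xE] := decomp_proj_expansion x; have [yD yE] := decomp_proj_expansion y.
suff /expansion_unique/(congr1 (@^~ i)) <- : expansion D (a *: x + y)
  (fun i => a *: decomp_proj D i x + decomp_proj D i y) by [].
split=> [k|]; first by have [_ _] := hD.1 k; exact.
rewrite (_ : summability.partial_sum _ = fun A =>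
    a *: summability.partial_sum (fun i => decomp_proj D i x) A +
    summability.partial_sum (fun i => decomp_proj D i y) A).
  by apply: cvgD => //; apply: cvgZl_tmp.
by apply/funext => A; rewrite /summability.partial_sum big_split/= scaler_sumr.
Qed.

Lemma decomp_fproj_cvg x (e : R) : 0 < e ->
  exists A0, forall A, (A0 `<=` A)%fset -> `|decomp_fproj D A x - x| < e.
Proof.
move=> e0; have [_ /cvgrPdistC_lt /(_ e e0) [A0 _ HA]] := decomp_proj_expansion x.
exists A0 => A /HA /=; rewrite /summability.partial_sum /decomp_fproj.
by rewrite big_seq_fsetE.
Qed.

Lemma decomp_fprojB (A B : {fset I}) x : (A `<=` B)%fset ->
  decomp_fproj D B x - decomp_fproj D A x = decomp_fproj D (B `\` A)%fset x.
Proof.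
move=> AB; rewrite /decomp_fproj (big_fsetID _ (mem A))/=.
rewrite addrC (_ : [fset x | x in B & mem A x]%fset = A); last first.
  apply/fsetP => i; rewrite !inE/=; apply/andP/idP => [[]//|iA].
  by split=> //; exact: (fsubsetP AB).
rewrite addrK; apply: eq_fbigl => i; rewrite !inE/= andbC//.
Qed.

Variables (p c : R) (p1 : 1 < p) (c0 : 0 < c).
Hypothesis hp : forall (r : nat) (C : 'I_r -> {fset I}),
  (forall k l, k != l -> [disjoint C k & C l]%fset) ->
  forall x, (\sum_(k < r) `|decomp_fproj D (C k) x| `^ p) `^ p^-1 <= c * `|x|.

(** The lower estimate for a single finite set bounds the projections
onto all finite sets of indices by the same constant. *)
Lemma decomp_fproj_bounded A : bounded_op c (decomp_fproj D A).
Proof.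
split=> [|a x y|x]; first exact: ltW.
  rewrite /decomp_fproj scaler_sumr -big_split; apply: eq_bigr => i _ /=.
  exact: decomp_proj_linear.
have p0 : p != 0 by rewrite gt_eqF// (lt_trans ltr01 p1).
have := @hp 1 (fun=> A) _ x; rewrite big_ord1 -powRrM divff//.
by rewrite powRr1//; apply => k l; rewrite !ord1 eqxx.
Qed.

Lemma decomp_fproj_lower_estimate (A : nat -> {fset I}) N x :
  (forall m n, (m <= n)%N -> (A m `<=` A n)%fset) ->
  \sum_(0 <= k < N) `|decomp_fproj D (A k.+1) x - decomp_fproj D (A k) x| `^ p
    <= (c * `|x|) `^ p.
Proof.
move=> Ale; have p0 : p != 0 by rewrite gt_eqF// (lt_trans ltr01 p1).
under eq_bigr do rewrite decomp_fprojB ?Ale//.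
rewrite big_mkord.
set S := \sum_(_ < _) _.
have S0 : 0 <= S by apply: sumr_ge0 => k _; exact: powR_ge0.
rewrite -[S]powRr1// -(mulVf p0) powRrM.
rewrite ge0_ler_powR ?nnegrE ?powR_ge0 ?(ltW (lt_trans ltr01 p1))//.
  by rewrite mulr_ge0// ltW.
apply: (@hp N (fun k => A k.+1 `\` A k)%fset) => k l.
wlog kl : k l / (k < l)%N.
  move=> H; rewrite neq_ltn => /orP[] lt; first by apply: H => //; rewrite neq_ltn lt.
  by rewrite fdisjoint_sym; apply: H => //; rewrite neq_ltn lt.
move=> _; apply/fdisjointP => i; rewrite !inE => /andP[_ /(fsubsetP (Ale _ _ kl)) ->].
by [].
Qed.

End decomposition.

(** What the proof retains of a decomposition: partial-sum projections along
an enumeration of the index set.  The last condition is the lower estimate for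
the successive blocks of indices cut out by phi. *)
Definition projection_sequence (R : realType) (X : completeNormedModType R)
    (p c : R) (P : nat -> X -> X) : Prop :=
  [/\ 0 < c, forall n, bounded_op c (P n), forall n, finite_rank (P n),
      (forall x (e : R), 0 < e -> exists N, forall n, (N <= n)%N -> `|P n x - x| <= e) &
      forall phi N x, {homo phi : m n / (m < n)%N} ->
        \sum_(0 <= k < N) `|P (phi k.+1) x - P (phi k) x| `^ p <= (c * `|x|) `^ p].

Lemma fdd_projection_sequence (R : realType) (X : completeNormedModType R)
    (I : choiceType) (D : I -> set X) (p : R) :
  1 < p -> countable [set: I] -> uncond_fdd D -> disjoint_lower_estimate p D ->
  exists c (P : nat -> X -> X), projection_sequence p c P.
Proof.
move=> p1 /countable_injP[f finj] [hD Dfin] [c c0 hp].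
pose A n := fset_set [set i | (f i < n)%N].
have inA n i : (i \in A n) = (f i < n)%N.
  rewrite in_fset_set; first by apply/idP/idP; rewrite inE.
  apply: (@finite_preimage _ _ `I_n f) (finite_II n).
  by move=> i' j' _ _; apply: finj; rewrite inE.
have Ale m n : (m <= n)%N -> (A m `<=` A n)%fset.
  by move=> mn; apply/fsubsetP => i; rewrite !inA => /leq_trans; apply.
have bnd := decomp_fproj_bounded hD p1 c0 hp.
exists c, (fun n => decomp_fproj D (A n)); split=> // [n|x e e0|phi N x phi_lt].
- apply: finite_rank_sum => i; have [m [v Dv]] := Dfin i.
  have iE : decomp_proj D i = decomp_fproj D [fset i]%fset.
    by apply/funext => x; rewrite /decomp_fproj big_seq_fset1.
  apply: (@finite_dim_range _ X X m c _ v); first by rewrite iE.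
  move=> x; have [/(_ i)] := decomp_proj_expansion hD x.
  by rewrite {1}Dv => -[a _ <-]; exists a.
- have [A0 HA] := decomp_fproj_cvg hD x e0.
  exists (\max_(i <- A0) (f i).+1)%N => n Nn; apply/ltW/HA/fsubsetP => i iA0.
  by rewrite inA; apply: leq_trans Nn; exact: (@leq_bigmax_seq _ _ xpredT (fun i => (f i).+1)).
- apply: (decomp_fproj_lower_estimate p1 c0 hp (A := A \o phi)) => m n mn.
  by apply: Ale; exact: (ltnW_homo phi_lt).
Qed.

(** * Finite-rank parts and tails in the tensor product *)

Section sum_of_products.
Context {R : realType}.
Variables (p q : R) (p1 : 1 < p) (q1 : 1 < q) (pq : 1 <= 1 / p + 1 / q).

Let p0 : 0 < p. Proof. exact: lt_trans p1. Qed.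
Let q0 : 0 < q. Proof. exact: lt_trans q1. Qed.

Lemma le_powR_root (r u m : R) : 0 < r -> 0 <= u -> u `^ r <= m -> u <= m `^ (1 / r).
Proof.
move=> r0 u0 um.
have -> : u = (u `^ r) `^ (1 / r) by rewrite -powRrM mulrCA divff ?gt_eqF// mulr1 powRr1.
have um0 : 0 <= u `^ r by exact: powR_ge0.
rewrite ge0_ler_powR ?nnegrE//; first by rewrite divr_ge0// ltW.
exact: le_trans um.
Qed.

(** With m the larger of s^p and t^q, the product s t is at most
m^(1/p + 1/q), and this is at most m because m <= 1 and the exponent is at
least 1. *)
Lemma mul_le_powR_add (s t : R) : 0 <= s <= 1 -> 0 <= t <= 1 ->
  s * t <= s `^ p + t `^ q.
Proof.
move=> /andP[s0 s1] /andP[t0 t1].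
move: s0; rewrite le_eqVlt => /predU1P[<-|s0]; first by rewrite mul0r addr_ge0 ?powR_ge0.
pose m := Num.max (s `^ p) (t `^ q).
have m0 : 0 < m by rewrite lt_max powR_gt0.
have m1 : m <= 1.
  have le1 (r u : R) : 0 < r -> 0 <= u -> u <= 1 -> u `^ r <= 1.
    move=> r0 u0 u1; have -> : 1 = 1 `^ r :> R by rewrite powR1.
    by rewrite ge0_ler_powR ?nnegrE// ltW.
  by rewrite ge_max !le1// ltW.
have sm : s <= m `^ (1 / p) by apply: le_powR_root; [|exact: ltW|rewrite le_max lexx].
have tm : t <= m `^ (1 / q) by apply: le_powR_root; rewrite // le_max lexx orbT.
apply: (@le_trans _ _ (m `^ (1 / p) * m `^ (1 / q))); first by apply: ler_pM => //; exact: ltW.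
rewrite -powRD ?(gt_eqF m0) ?implybT//.
apply: (@le_trans _ _ m); first by rewrite ge1r_powR// m0.
by rewrite ge_max lerDl lerDr !powR_ge0.
Qed.

Lemma term_le (r : R) (a : nat -> R) (A : R) N k : 0 < r ->
  (forall k, 0 <= a k) -> 0 <= A ->
  \sum_(0 <= k < N) a k `^ r <= A `^ r -> (k < N)%N -> a k <= A.
Proof.
move=> r0 a0 A0 H kN; rewrite leNgt; apply/negP => Aa.
have := gt0_ltr_powR r0 _ _ Aa; rewrite !nnegrE => /(_ A0 (a0 k)).
rewrite ltNge => /negP; apply; apply: le_trans H.
rewrite big_mkord (bigD1 (Ordinal kN))//= lerDl sumr_ge0// => i _.
exact: powR_ge0.
Qed.

(** The inequality of Hoelder up to the factor 2, for 1/p + 1/q >= 1: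
normalise both sequences and apply [mul_le_powR_add] termwise. *)
Lemma sum_mul_le (a b : nat -> R) (A B : R) N :
  (forall k, 0 <= a k) -> (forall k, 0 <= b k) -> 0 <= A -> 0 <= B ->
  \sum_(0 <= k < N) a k `^ p <= A `^ p -> \sum_(0 <= k < N) b k `^ q <= B `^ q ->
  \sum_(0 <= k < N) a k * b k <= 2 * (A * B).
Proof.
move=> a0 b0 A0 B0 aA bB.
have aleA k : (k < N)%N -> a k <= A by exact: term_le aA.
have bleB k : (k < N)%N -> b k <= B by exact: term_le bB.
move: (A0); rewrite le_eqVlt => /predU1P[A00|A_gt0].
  rewrite big_nat big1 => [|k kN]; first by rewrite !mulr_ge0.
  by have /le_anti -> : a k <= 0 <= a k; [rewrite {1}A00 aleA/=|rewrite mul0r].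
move: (B0); rewrite le_eqVlt => /predU1P[B00|B_gt0].
  rewrite big_nat big1 => [|k kN]; first by rewrite !mulr_ge0.
  by have /le_anti -> : b k <= 0 <= b k; [rewrite {1}B00 bleB/=|rewrite mulr0].
have norm1 (r : R) (u : nat -> R) (U : R) : (forall k, 0 <= u k) -> 0 < U ->
    \sum_(0 <= k < N) u k `^ r <= U `^ r -> \sum_(0 <= k < N) (u k / U) `^ r <= 1.
  move=> u0 U0 uU; have Ur : 0 < U `^ r by exact: powR_gt0.
  have UV : U^-1 `^ r = (U `^ r)^-1.
    by rewrite -powR_inv1 ?ltW// -powRrM mulN1r powRN.
  rewrite (eq_bigr (fun k => u k `^ r / U `^ r)) => [|k _]; last first.
    by rewrite powRM ?invr_ge0 ?(ltW U0)// UV.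
  by rewrite -mulr_suml ler_pdivrMr// mul1r.
have aN := norm1 p a A a0 A_gt0 aA; have bN := norm1 q b B b0 B_gt0 bB.
rewrite -ler_pdivrMr ?mulr_gt0// mulr_suml.
apply: (@le_trans _ _ (\sum_(0 <= k < N) ((a k / A) `^ p + (b k / B) `^ q))); last first.
  by rewrite big_split/=; move: aN bN; lra.
rewrite big_nat [leRHS]big_nat; apply: ler_sum => k kN.
rewrite invfM mulrACA; apply: mul_le_powR_add.
  by rewrite divr_ge0//= ler_pdivrMr// mul1r aleA.
by rewrite divr_ge0//= ler_pdivrMr// mul1r bleB.
Qed.

End sum_of_products.

Section tensor_operators.
Context {R : realType} {X Y Z : completeNormedModType R}.
Context (b : {bilinear X -> Y -> Z}).
Hypothesis hZ : is_projective_tensor b.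

(** For P = sum_i f_i w_i the operator L = P (x) 1 is
sum_i b w_i (F_i z), where F_i extends (x, y) |-> f_i x *: y to a bounded operator
into Y.  The bound c does not come from this formula, but from the elementary
tensors. *)
Lemma cwc_approximable_tensor_id c (P : X -> X) :
  bounded_op c P -> finite_rank P -> cwc_approximable (@id Y) ->
  exists L : Z -> Z,
    [/\ bounded_op c L, cwc_approximable L & forall x y, L (b x y) = b (P x) y].
Proof.
move=> Pc Pr Yt.
suff [K [L [LK Lt Lb]]] : exists K (L : Z -> Z),
    [/\ bounded_op K L, cwc_approximable L & forall x y, L (b x y) = b (P x) y].
  exists L; split=> //; apply: (bounded_op_tensor hZ LK (bounded_op_ge0 Pc)) => x y.
  rewrite Lb (le_trans (norm_tensor_le hZ _ _))// mulrA ler_wpM2r//.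
  exact: bounded_op_le.
elim: {P Pc} Pr => [|K f w P fK _ [K' [L [LK Lt Lb]]]].
  exists 0, (fun=> 0); split=> [||x y]; [exact: bounded_op_zero|exact: cwc_approximable_zero|].
  by rewrite linear0l.
have [|F FK Fb] := tensor_extension hZ (K := K) (B := fun x y => f x *: y).
  split=> [|y a u v|x a u v|x y]; first exact: bounded_op_ge0 fK.
  - by rewrite (bounded_opP fK) scalerDl scalerA.
  - by rewrite scalerDr !scalerA mulrC.
  - by rewrite normrZ mulrA ler_wpM2r//; exact: bounded_op_le.
have wK : bounded_op `|w| (b w).
  by split=> // [a u v|y]; [rewrite linearPr|exact: norm_tensor_le].
exists (`|w| * K + K'), (fun z => b w (F z) + L z); split=> [||x y].
- exact: bounded_op_add (bounded_op_comp wK FK) LK.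
- apply: cwc_approximable_add Lt; apply: (cwc_approximable_comp_left wK (S := F)).
  exact: cwc_approximable_comp FK Yt.
- by rewrite Fb Lb linearDl linearZr_LR linearZl_LR.
Qed.

(** The mirror image of [cwc_approximable_tensor_id]. *)
Lemma cwc_approximable_id_tensor c (Q : Y -> Y) :
  bounded_op c Q -> finite_rank Q -> cwc_approximable (@id X) ->
  exists L : Z -> Z,
    [/\ bounded_op c L, cwc_approximable L & forall x y, L (b x y) = b x (Q y)].
Proof.
move=> Qc Qr Xt.
suff [K [L [LK Lt Lb]]] : exists K (L : Z -> Z),
    [/\ bounded_op K L, cwc_approximable L & forall x y, L (b x y) = b x (Q y)].
  exists L; split=> //; apply: (bounded_op_tensor hZ LK (bounded_op_ge0 Qc)) => x y.
  rewrite Lb (le_trans (norm_tensor_le hZ _ _))// mulrCA ler_wpM2l//.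
  exact: bounded_op_le.
elim: {Q Qc} Qr => [|K f w Q fK _ [K' [L [LK Lt Lb]]]].
  exists 0, (fun=> 0); split=> [||x y]; [exact: bounded_op_zero|exact: cwc_approximable_zero|].
  by rewrite linear0r.
have [|F FK Fb] := tensor_extension hZ (K := K) (B := fun x y => f y *: x).
  split=> [|y a u v|x a u v|x y]; first exact: bounded_op_ge0 fK.
  - by rewrite scalerDr !scalerA mulrC.
  - by rewrite (bounded_opP fK) scalerDl scalerA.
  - rewrite normrZ (mulrC `|x|) mulrA ler_wpM2r//; exact: bounded_op_le.
have wK : bounded_op `|w| (b^~ w).
  by split=> // [a u v|x]; [rewrite linearPl|rewrite mulrC; exact: norm_tensor_le].
exists (`|w| * K + K'), (fun z => b (F z) w + L z); split=> [||x y].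
- exact: bounded_op_add (bounded_op_comp wK FK) LK.
- apply: cwc_approximable_add Lt; apply: (cwc_approximable_comp_left wK (S := F)).
  exact: cwc_approximable_comp FK Xt.
- by rewrite Fb Lb linearDr linearZr_LR linearZl_LR.
Qed.

Lemma tensor_strong_cvg (c : R) (T : nat -> Z -> Z) : 0 <= c ->
  (forall n, bounded_op c (T n)) ->
  (forall x y (e : R), 0 < e ->
    exists N, forall n, (N <= n)%N -> `|T n (b x y) - b x y| <= e) ->
  forall z (e : R), 0 < e -> exists N, forall n, (N <= n)%N -> `|T n z - z| <= e.
Proof.
move=> c0 Tc Tb.
have Ts s (e : R) : 0 < e -> exists N, forall n, (N <= n)%N ->
    `|T n (tensor_sum b s) - tensor_sum b s| <= e.
  elim: s e => [|[x y] s ih] e e0.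
    exists 0%N => n _; rewrite /tensor_sum big_nil (bounded_op0 (Tc n)).
    by rewrite subrr normr0 ltW.
  have e20 : 0 < e / 2 by rewrite divr_gt0.
  have [N HN] := ih _ e20; have [M HM] := Tb x y _ e20.
  exists (maxn N M) => n; rewrite geq_max => /andP[/HN h1 /HM h2].
  rewrite /tensor_sum big_cons/= -/(tensor_sum b s) (bounded_opD (Tc n)).
  by rewrite opprD addrACA [leRHS]splitr (le_trans (ler_normD _ _))// lerD.
move=> z e e0.
have d0 : 0 < e / 2 / (c + 1) by rewrite !divr_gt0// ltr_wpDl.
have e20 : 0 < e / 2 by rewrite divr_gt0.
have [s Hs] := tensor_sum_dense hZ z d0; have [N HN] := Ts s _ e20.
exists N => n /HN h; set w := tensor_sum b s in Hs h.
rewrite (_ : T n z - z = T n (z - w) + ((T n w - w) - (z - w))); last first.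
  by rewrite (bounded_opB (Tc n)) opprB !subrKA.
have h1 := le_trans (bounded_op_le (Tc n) (z - w)) (ler_wpM2l c0 (ltW Hs)).
have h2 := ler_normD (T n (z - w)) ((T n w - w) - (z - w)).
have h3 := ler_normB (T n w - w) (z - w).
have : e / 2 = c * (e / 2 / (c + 1)) + e / 2 / (c + 1).
  by field; rewrite gt_eqF// ltr_wpDl.
move: h h1 h2 h3 Hs; lra.
Qed.

End tensor_operators.

Section main.
Context {R : realType} {X Y Z : completeNormedModType R}.
Context (b : {bilinear X -> Y -> Z}).
Hypothesis hZ : is_projective_tensor b.
Variables (p q : R) (p1 : 1 < p) (q1 : 1 < q) (pq : 1 <= 1 / p + 1 / q).
Variables (c d : R) (P : nat -> X -> X) (Q : nat -> Y -> Y).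
Hypothesis hP : projection_sequence p c P.
Hypothesis hQ : projection_sequence q d Q.
Variables L M : nat -> Z -> Z.
Hypothesis (Lc : forall n, bounded_op c (L n)) (Mc : forall n, bounded_op d (M n)).
Hypothesis Lb : forall n x y, L n (b x y) = b (P n x) y.
Hypothesis Mb : forall n x y, M n (b x y) = b x (Q n y).

(** This is (1 - P_n) (x) (1 - Q_n), written with L n = P_n (x) 1 and
M n = 1 (x) Q_n. *)
Definition tail_op n z := (z - M n z) - L n (z - M n z).
(** This is (P_m - P_n) (x) (Q_m - Q_n), written with L = P (x) 1 and
M = 1 (x) Q. *)
Definition block_op n m z := L m (M m z - M n z) - L n (M m z - M n z).

Lemma block_tensor n m x y : block_op n m (b x y) = b (P m x - P n x) (Q m y - Q n y).
Proof.
by rewrite /block_op !Mb -linearBr !Lb -linearBl.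
Qed.

Lemma block_bounded n m : exists K, bounded_op K (block_op n m).
Proof.
have MK := bounded_op_sub (Mc m) (Mc n).
by eexists; apply: bounded_op_sub (bounded_op_comp (Lc m) MK) (bounded_op_comp (Lc n) MK).
Qed.

Lemma L_cvg z (e : R) : 0 < e -> exists N, forall n, (N <= n)%N -> `|L n z - z| <= e.
Proof.
have [c0 _ _ Px _] := hP.
apply: (tensor_strong_cvg hZ (ltW c0) Lc) => x y e' e'0.
have y0 : 0 < `|y| + 1 by rewrite ltr_wpDl.
have [|N HN] := Px x (e' / (`|y| + 1)); first by rewrite divr_gt0.
exists N => n /HN h; rewrite Lb -linearBl (le_trans (norm_tensor_le hZ _ _))//.
rewrite (le_trans (ler_wpM2r _ h))// -mulrA ler_piMr ?ltW//.
by rewrite mulrC ltr_pdivrMr// mul1r ltrDl.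
Qed.

Lemma M_cvg z (e : R) : 0 < e -> exists N, forall n, (N <= n)%N -> `|M n z - z| <= e.
Proof.
have [d0 _ _ Qy _] := hQ.
apply: (tensor_strong_cvg hZ (ltW d0) Mc) => x y e' e'0.
have x0 : 0 < `|x| + 1 by rewrite ltr_wpDl.
have [|N HN] := Qy y (e' / (`|x| + 1)); first by rewrite divr_gt0.
exists N => n /HN h; rewrite Mb -linearBr (le_trans (norm_tensor_le hZ _ _))//.
rewrite (le_trans (ler_wpM2l _ h))// mulrCA ler_piMr ?ltW//.
by rewrite ltr_pdivrMr// mul1r ltrDl.
Qed.

Lemma block_cvg_tail n z (e : R) : 0 < e ->
  exists N, forall m, (N <= m)%N -> `|block_op n m z - tail_op n z| <= e.
Proof.
move=> e0; have [c0 _ _ _ _] := hP.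
have e20 : 0 < e / 2 by rewrite divr_gt0.
have d0 : 0 < e / 2 / (2 * c) by rewrite divr_gt0// mulr_gt0.
have [N1 H1] := M_cvg z d0; have [N2 H2] := L_cvg (z - M n z) e20.
exists (maxn N1 N2) => m; rewrite geq_max => /andP[/H1 h1 /H2 h2].
set y := z - M n z in h2 *.
rewrite /block_op /tail_op -/y.
have -> : M m z - M n z = (M m z - z) + y by rewrite /y addrA subrK.
rewrite (bounded_opD (Lc m)) (bounded_opD (Lc n)).
set w := M m z - z in h1 *.
have -> : L m w + L m y - (L n w + L n y) - (y - L n y) = (L m w - L n w) + (L m y - y).
  by rewrite (opprD (L n w)) addrACA -(addrA (L m w - _)) opprB subrKA.
rewrite (le_trans (ler_normD _ _))// [leRHS]splitr lerD//.
rewrite (le_trans (ler_normB _ _))//.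
have := bounded_op_le (Lc m) w; have := bounded_op_le (Lc n) w.
move: h1; rewrite ler_pdivlMr ?mulr_gt0//; lra.
Qed.

(** With the signs of the terms at z frozen, the left-hand side is the value
at z of one functional, whose norm can be estimated on elementary tensors; there
the lower estimates of X and Y apply. *)
Lemma block_functionals_sum phi (g : nat -> Z -> R^o) z N :
  {homo phi : m n / (m < n)%N} -> (forall k, bounded_op 1 (g k)) ->
  \sum_(0 <= k < N) `|g k (block_op (phi k) (phi k.+1) z)| <= 2 * (c * d) * `|z|.
Proof.
move=> phi_lt g1.
have [c0 _ _ _ hPp] := hP; have [d0 _ _ _ hQq] := hQ.
pose psi k z := g k (block_op (phi k) (phi k.+1) z).
have psiK k : exists K, bounded_op K (psi k).
  have [K BK] := block_bounded (phi k) (phi k.+1).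
  by eexists; exact: bounded_op_comp (g1 k) BK.
pose sgn k : R := Num.sg (psi k z).
pose F z' : R^o := \sum_(0 <= k < N) sgn k *: psi k z'.
have [K FK] : exists K, bounded_op K F.
  apply: bounded_op_bigsum => k; have [K psik] := psiK k.
  by exists (`|sgn k| * K); exact: (bounded_op_scale (sgn k) psik).
have -> : \sum_(0 <= k < N) `|psi k z| = F z.
  by apply: eq_bigr => k _; rewrite /sgn /GRing.scale/= -normrEsg.
apply: (le_trans (ler_norm _)).
suff /bounded_op_le : bounded_op (2 * (c * d)) F by exact.
apply: (bounded_op_tensor hZ FK); first by rewrite !mulr_ge0// ltW.
move=> x y; have -> : 2 * (c * d) * (`|x| * `|y|) = 2 * ((c * `|x|) * (d * `|y|)) by ring.
apply: (le_trans (ler_norm_sum _ _ _)).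
apply: le_trans (sum_mul_le p1 q1 pq _ _ _ _ (hPp phi N x phi_lt)
  (hQq phi N y phi_lt)) => //; last 2 first.
- by rewrite mulr_ge0// ltW.
- by rewrite mulr_ge0// ltW.
apply: ler_sum => k _.
apply: (@le_trans _ _ `|psi k (b x y)|).
  by rewrite normrZ ler_piMl// normr_sg; case: (_ != 0).
apply: (le_trans (bounded_op_le (g1 k) _)).
by rewrite mul1r block_tensor norm_tensor_le.
Qed.

(** If the tail of z_n exceeds e for every n, then so does a block of z_n from
n to some later m, since blocks converge to the tail.  Consecutive blocks of
this kind contradict [schur_diagonal]. *)
Lemma tail_uniform (C : set Z) (e : R) : cond_weakly_compact C -> 0 < e ->
  exists n, forall z, C z -> `|tail_op n z| <= e.
Proof.
move=> CC e0; apply: contrapT => nC.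
have /choice[z Hz] : forall n, exists z, C z /\ e < `|tail_op n z|.
  move=> n; apply: contrapT => Hn; apply: nC; exists n => z Cz.
  by rewrite leNgt; apply/negP => h; apply: Hn; exists z.
have [|phi phi_lt Hphi] := @dependent_subsequence (fun n m => e <= `|block_op n m (z n)|).
  move=> n; have /block_cvg_tail -/(_ n (z n)) [N HN] : 0 < `|tail_op n (z n)| - e.
    by rewrite subr_gt0 (Hz n).2.
  exists (maxn n.+1 N); first by rewrite leq_maxl.
  have := HN _ (leq_maxr n.+1 N); set B := block_op _ _ _; set T := tail_op _ _.
  have := lerB_dist T B; rewrite distrC; lra.
have /choice[g Hg] : forall k, exists g : Z -> R^o, bounded_op 1 g /\
    g (block_op (phi k) (phi k.+1) (z (phi k))) = `|block_op (phi k) (phi k.+1) (z (phi k))|.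
  by move=> k; have [g] := norming_bounded_op (block_op (phi k) (phi k.+1) (z (phi k))); exists g.
have [c0 _ _ _ _] := hP; have [d0 _ _ _ _] := hQ.
apply: (@schur_diagonal _ _ (fun k z => g k (block_op (phi k) (phi k.+1) z))
    (2 * (c * d)) C (z \o phi) e) => //.
- by rewrite !mulr_ge0// ltW.
- move=> k; have [K BK] := block_bounded (phi k) (phi k.+1).
  by eexists; exact: bounded_op_comp (Hg k).1 BK.
- by move=> z' N; apply: block_functionals_sum => // k; case: (Hg k).
- by move=> k; case: (Hz (phi k)).
- by move=> k /=; rewrite (Hg k).2 normr_id.
Qed.

End main.

Theorem theorem3p13 (R : realType) (p q : R)
    (hp : 1 < p) (hq : 1 < q) (hpq : 1 <= 1 / p + 1 / q)
    (X Y : completeNormedModType R) (I J : choiceType)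
    (XI : I -> set X) (YJ : J -> set Y)
    (hXI : uncond_fdd XI) (hYJ : uncond_fdd YJ)
    (hXp : disjoint_lower_estimate p XI)
    (hYq : disjoint_lower_estimate q YJ)
    (hI : countable [set: I]) (hJ : countable [set: J])
    (hX : SCWCG X) (hY : SCWCG Y)
    (Z : completeNormedModType R) (b : {bilinear X -> Y -> Z})
    (hZ : is_projective_tensor b) :
  SCWCG Z.
Proof.
have [c [P hP]] := fdd_projection_sequence hp hI hXI hXp.
have [d [Q hQ]] := fdd_projection_sequence hq hJ hYJ hYq.
have [_ Pc Pr _ _] := hP; have [_ Qd Qr _ _] := hQ.
have /choice[L HL] := fun n =>
  cwc_approximable_tensor_id hZ (Pc n) (Pr n) (SCWCG_cwc_approximable hY).
have /choice[M HM] := fun n =>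
  cwc_approximable_id_tensor hZ (Qd n) (Qr n) (SCWCG_cwc_approximable hX).
have Lc n : bounded_op c (L n) by case: (HL n).
have Md n : bounded_op d (M n) by case: (HM n).
apply: cwc_approximable_SCWCG.
(* z - (M n z + L n (z - M n z)) is the tail of z *)
apply: (@cwc_approximable_limit _ _ _ _ (fun n z => M n z + L n (z - M n z)))
  => [n|C CC e e0].
  apply: cwc_approximable_add; first by case: (HM n).
  apply: (@cwc_approximable_comp _ _ _ _ _ (L n) (fun z => z - M n z)); last by case: (HL n).
  exact: bounded_op_sub (bounded_op_id Z) (Md n).
have [n x y|n x y|n Hn] := tail_uniform hZ hp hq hpq hP hQ Lc Md _ _ CC e0.
- by case: (HL n).
- by case: (HM n).
by exists n => z /Hn; rewrite /tail_op opprD addrA.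
Qed.
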